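(* Let $\mathbb{F}$ be a field, $\Gamma$ an arbitrary digraph and $J$ a two-sided ideal of the Leavitt path algebra $L(\Gamma)=L_{\mathbb{F}}(\Gamma)$. The quotient $L(\Gamma)/J$ is isomorphic (as an $\mathbb{F}$-algebra) to a Leavitt path algebra $L_{\mathbb{F}}(\Lambda)$ of some digraph $\Lambda$ if and only if $J$ is a dlf ideal of $L(\Gamma)$.
   Context: A digraph $\Gamma=(V,E,s,t)$ consists of arbitrary (possibly infinite) sets $V$ of vertices and $E$ of arrows and functions $s,t:E\to V$ (source, target). The Leavitt path algebra $L(\Gamma)=L_{\mathbb{F}}(\Gamma)$ is the (not necessarily unital) $\mathbb{F}$-algebra generated by $V\sqcup E\sqcup\{e^*: e\in E\}$ subject to: $uv=\delta_{u,v}u$ for $u,v\in V$; $s(e)e=e=e\,t(e)$ and $t(e)e^*=e^*=e^*s(e)$ for $e\in E$; (CK1) $e^*f=\delta_{e,f}t(e)$ for $e,f\in E$; (CK2) $v=\sum_{s(e)=v}ee^*$ for every $v\in V$ with $0<|s^{-1}(v)|<\infty$. A path of length $n>0$ is a sequence of arrows $e_1\cdots e_n$ with $t(e_i)=s(e_{i+1})$. A cycle is a path $C=e_1\cdots e_n$ with $n>0$, $s(C)=t(C)$ and the vertices $s(e_1),\dots,s(e_n)$ pairwise distinct. For a cycle $C$, $\mathbb{F}[C]$ is the subalgebra of $L(\Gamma)$ spanned by $s(C),C,C^2,\dots$ (with identity $s(C)$); it is isomorphic to $\mathbb{F}[x]$ via $C\leftrightarrow x$. Canonical polynomial generators: let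 $J$ be an ideal of $L(\Gamma)$. For each cycle $C$ such that $J\cap\mathbb{F}[C]$ is a proper nonzero ideal of $\mathbb{F}[C]$, let $f_C(x)\in\mathbb{F}[x]$ be the unique generator with $f_C(0)=1$ of the ideal of $\mathbb{F}[x]$ corresponding to $J\cap\mathbb{F}[C]$. The elements $f_C(C)$ (constant term read as $s(C)$) are the canonical polynomial generators of $J$. The ideal $J$ is called dlf (distinct linear factors) if for every canonical polynomial generator $f_C(C)$ of $J$ the polynomial $f_C(x)$ is a product of distinct linear factors in $\mathbb{F}[x]$. (If $J$ has no canonical polynomial generators it is vacuously dlf.) *)

(* Defs.v *)
From HB Require Import structures.
From Stdlib Require List.
From mathcomp Require Import all_boot all_algebra.
From mathcomp Require Import boolp classical_sets.

Set Implicit Arguments.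
Unset Strict Implicit.
Unset Printing Implicit Defensive.

Import GRing.Theory.
Local Open Scope ring_scope.
Local Open Scope quotient_scope.

Declare Scope nualg_scope.
Delimit Scope nualg_scope with nu.
Local Open Scope nualg_scope.

(** * Associative, not necessarily unital, algebras over a field *)

HB.mixin Record Lmodule_isNUAlgebra (F : fieldType) V of GRing.Lmodule F V := {
  numul : V -> V -> V;
  numulA : associative numul;
  numulDl : left_distributive numul +%R;
  numulDr : right_distributive numul +%R;
  numulZl : forall (a : F) (x y : V), numul (a *: x) y = a *: numul x y;
  numulZr : forall (a : F) (x y : V), numul x (a *: y) = a *: numul x y
}.

#[short(type="nuAlgType")]
HB.structure Definition NUAlgebra (F : fieldType) :=
  {V of Lmodule_isNUAlgebra F V & GRing.Lmodule F V}.

Notation "x ** y" := (numul x y) (at level 40, left associativity)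
  : nualg_scope.

Definition nualg_isomorphic (F : fieldType) (A B : nuAlgType F) : Prop :=
  exists f : {linear A -> B}, {morph f : x y / x ** y} /\ bijective f.

(** * Two-sided ideals and quotients *)

Record ideal (F : fieldType) (A : nuAlgType F) := Ideal {
  ideal_set :> A -> Prop;
  ideal0 : ideal_set 0;
  idealD : forall x y, ideal_set x -> ideal_set y -> ideal_set (x + y);
  idealZ : forall (a : F) x, ideal_set x -> ideal_set (a *: x);
  idealMl : forall x y, ideal_set y -> ideal_set (x ** y);
  idealMr : forall x y, ideal_set x -> ideal_set (x ** y)
}.

Section IdealQuotient.
Variables (F : fieldType) (A : nuAlgType F) (J : ideal A).

Definition ideal_equiv : rel A := fun x y => `[< J (x - y) >].

Lemma idealN x : J x -> J (- x).
Proof. by rewrite -scaleN1r; apply: idealZ. Qed.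

Lemma ideal_equiv_refl : reflexive ideal_equiv.
Proof. by move=> x; apply/asboolP; rewrite subrr; apply: ideal0. Qed.

Lemma ideal_equiv_sym : symmetric ideal_equiv.
Proof.
by move=> x y; apply/asboolP/asboolP => /idealN; rewrite opprB.
Qed.

Lemma ideal_equiv_trans : transitive ideal_equiv.
Proof.
move=> y x z /asboolP xy /asboolP yz; apply/asboolP.
by rewrite -(subrK y x) -addrA; apply: idealD.
Qed.

Canonical ideal_equiv_rel :=
  EquivRel ideal_equiv ideal_equiv_refl ideal_equiv_sym ideal_equiv_trans.

Definition quot := {eq_quot ideal_equiv_rel}.
HB.instance Definition _ := Choice.on quot.
HB.instance Definition _ := EqQuotient.on quot.

Lemma quotP (x y : A) : \pi_quot x = \pi_quot y <-> J (x - y).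
Proof.
by split=> [/eqquotP/asboolP | Jxy] //; apply/eqquotP/asboolP.
Qed.

Lemma quot_ind (P : quot -> Prop) : (forall x, P (\pi_quot x)) -> forall u, P u.
Proof. by move=> Px u; rewrite -(reprK u). Qed.

Lemma quot_reprP (x : A) : J (repr (\pi_quot x) - x).
Proof. by apply/quotP; rewrite reprK. Qed.

Definition quot_add (u v : quot) : quot := \pi_quot (repr u + repr v).
Definition quot_opp (u : quot) : quot := \pi_quot (- repr u).
Definition quot_scale (a : F) (u : quot) : quot := \pi_quot (a *: repr u).
Definition quot_mul (u v : quot) : quot := \pi_quot (repr u ** repr v).

Lemma quot_addE x y : quot_add (\pi_quot x) (\pi_quot y) = \pi_quot (x + y).
Proof.
by apply/quotP; rewrite opprD addrACA; apply: idealD; apply: quot_reprP.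
Qed.

Lemma quot_oppE x : quot_opp (\pi_quot x) = \pi_quot (- x).
Proof. by apply/quotP; rewrite -opprD; apply: idealN; apply: quot_reprP. Qed.

Lemma quot_scaleE a x : quot_scale a (\pi_quot x) = \pi_quot (a *: x).
Proof. by apply/quotP; rewrite -scalerBr; apply: idealZ; apply: quot_reprP. Qed.

Lemma numulNl x y : (- x : A) ** y = - (x ** y).
Proof. by rewrite -scaleN1r numulZl scaleN1r. Qed.

Lemma numulNr x y : (x : A) ** (- y) = - (x ** y).
Proof. by rewrite -scaleN1r numulZr scaleN1r. Qed.

Lemma quot_mulE x y : quot_mul (\pi_quot x) (\pi_quot y) = \pi_quot (x ** y).
Proof.
apply/quotP; set x' := repr _; set y' := repr _.
have -> : x' ** y' - x ** y = (x' - x) ** y' + x ** (y' - y).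
  by rewrite numulDl numulDr numulNl numulNr addrA subrK.
apply: idealD; [apply: idealMr | apply: idealMl]; exact: quot_reprP.
Qed.

Lemma quot_addA : associative quot_add.
Proof.
move=> q; elim/quot_ind: q => x.
move=> q; elim/quot_ind: q => y.
move=> q; elim/quot_ind: q => z.
by rewrite !quot_addE addrA.
Qed.

Lemma quot_addC : commutative quot_add.
Proof.
move=> q; elim/quot_ind: q => x.
move=> q; elim/quot_ind: q => y.
by rewrite !quot_addE addrC.
Qed.

Lemma quot_add0 : left_id (\pi_quot 0) quot_add.
Proof.
move=> q; elim/quot_ind: q => x.
by rewrite quot_addE add0r.
Qed.

Lemma quot_addN : left_inverse (\pi_quot 0) quot_opp quot_add.
Proof.
move=> q; elim/quot_ind: q => x.
by rewrite quot_oppE quot_addE addNr.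
Qed.

HB.instance Definition _ :=
  GRing.isZmodule.Build quot quot_addA quot_addC quot_add0 quot_addN.

Lemma quotD : {morph \pi_quot : x y / x + y}.
Proof. by move=> x y; rewrite -quot_addE. Qed.

Lemma quot_scaleA a b u :
  quot_scale a (quot_scale b u) = quot_scale (a * b) u.
Proof. by elim/quot_ind: u => x; rewrite !quot_scaleE scalerA. Qed.

Lemma quot_scale1 : left_id 1 quot_scale.
Proof.
move=> q; elim/quot_ind: q => x.
by rewrite quot_scaleE scale1r.
Qed.

Lemma quot_scaleDr : right_distributive quot_scale +%R.
Proof.
move=> a q; elim/quot_ind: q => x.
move=> q; elim/quot_ind: q => y.
by rewrite -(quotD x y) !quot_scaleE -quotD scalerDr.
Qed.

Lemma quot_scaleDl u : {morph quot_scale^~ u : a b / a + b}.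
Proof.
by elim/quot_ind: u => x a b; rewrite !quot_scaleE -quotD scalerDl.
Qed.

HB.instance Definition _ := GRing.Zmodule_isLmodule.Build F quot
  quot_scaleA quot_scale1 quot_scaleDr quot_scaleDl.

Lemma quotZ a : {morph \pi_quot : x / a *: x}.
Proof. by move=> x; rewrite -quot_scaleE. Qed.

Lemma quot_mulA : associative quot_mul.
Proof.
move=> q; elim/quot_ind: q => x.
move=> q; elim/quot_ind: q => y.
move=> q; elim/quot_ind: q => z.
by rewrite !quot_mulE numulA.
Qed.

Lemma quot_mulDl : left_distributive quot_mul +%R.
Proof.
move=> q; elim/quot_ind: q => x.
move=> q; elim/quot_ind: q => y.
move=> q; elim/quot_ind: q => z.
by rewrite -(quotD x y) !quot_mulE -quotD numulDl.
Qed.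

Lemma quot_mulDr : right_distributive quot_mul +%R.
Proof.
move=> q; elim/quot_ind: q => x.
move=> q; elim/quot_ind: q => y.
move=> q; elim/quot_ind: q => z.
by rewrite -(quotD y z) !quot_mulE -quotD numulDr.
Qed.

Lemma quot_mulZl (a : F) (u v : quot) :
  quot_mul (a *: u) v = a *: quot_mul u v.
Proof.
elim/quot_ind: u => x; elim/quot_ind: v => y.
by rewrite -(quotZ a x) !quot_mulE -quotZ numulZl.
Qed.

Lemma quot_mulZr (a : F) (u v : quot) :
  quot_mul u (a *: v) = a *: quot_mul u v.
Proof.
elim/quot_ind: u => x; elim/quot_ind: v => y.
by rewrite -(quotZ a y) !quot_mulE -quotZ numulZr.
Qed.

HB.instance Definition _ := Lmodule_isNUAlgebra.Build F quot
  quot_mulA quot_mulDl quot_mulDr quot_mulZl quot_mulZr.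

Lemma quotM : {morph \pi_quot : x y / x ** y}.
Proof. by move=> x y; rewrite -quot_mulE. Qed.

End IdealQuotient.

(** * Algebras presented by generators and relations *)

Inductive term (F X : Type) : Type :=
| TGen of X
| TZero
| TAdd of term F X & term F X
| TScale of F & term F X
| TMul of term F X & term F X.
Arguments TGen {F X}.
Arguments TZero {F X}.

HB.instance Definition _ F X := gen_eqMixin (term F X).
HB.instance Definition _ F X := gen_choiceMixin (term F X).

Section Presentation.
Variables (F : fieldType) (X : Type).
Variable R : term F X -> term F X -> Prop.

(* The least congruence that contains R and makes the terms an associative
   algebra; the opposite of t is TScale (-1) t. *)
Inductive term_eq : term F X -> term F X -> Prop :=
| TeRel t u : R t u -> term_eq t u
| TeRefl t : term_eq t t
| TeSym t u : term_eq t u -> term_eq u t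
| TeTrans t u v : term_eq t u -> term_eq u v -> term_eq t v
| TeAdd t t' u u' :
    term_eq t t' -> term_eq u u' -> term_eq (TAdd t u) (TAdd t' u')
| TeScale a t t' : term_eq t t' -> term_eq (TScale a t) (TScale a t')
| TeMul t t' u u' :
    term_eq t t' -> term_eq u u' -> term_eq (TMul t u) (TMul t' u')
| TeAddA t u v : term_eq (TAdd t (TAdd u v)) (TAdd (TAdd t u) v)
| TeAddC t u : term_eq (TAdd t u) (TAdd u t)
| TeAdd0 t : term_eq (TAdd TZero t) t
| TeScale0 t : term_eq (TScale 0 t) TZero
| TeScale1 t : term_eq (TScale 1 t) t
| TeScaleA a b t : term_eq (TScale a (TScale b t)) (TScale (a * b) t)
| TeScaleDr a t u :
    term_eq (TScale a (TAdd t u)) (TAdd (TScale a t) (TScale a u))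
| TeScaleDl a b t :
    term_eq (TScale (a + b) t) (TAdd (TScale a t) (TScale b t))
| TeMulA t u v : term_eq (TMul t (TMul u v)) (TMul (TMul t u) v)
| TeMulDl t u v : term_eq (TMul (TAdd t u) v) (TAdd (TMul t v) (TMul u v))
| TeMulDr t u v : term_eq (TMul t (TAdd u v)) (TAdd (TMul t u) (TMul t v))
| TeMulZl a t u : term_eq (TMul (TScale a t) u) (TScale a (TMul t u))
| TeMulZr a t u : term_eq (TMul t (TScale a u)) (TScale a (TMul t u)).

Definition term_eqb : rel (term F X) := fun t u => `[< term_eq t u >].

Lemma term_eqb_refl : reflexive term_eqb.
Proof. by move=> t; apply/asboolP; apply: TeRefl. Qed.

Lemma term_eqb_sym : symmetric term_eqb.
Proof. by move=> t u; apply/asboolP/asboolP; apply: TeSym. Qed.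

Lemma term_eqb_trans : transitive term_eqb.
Proof.
by move=> u t v /asboolP tu /asboolP uv; apply/asboolP; apply: TeTrans tu uv.
Qed.

Canonical term_equiv_rel :=
  EquivRel term_eqb term_eqb_refl term_eqb_sym term_eqb_trans.

Definition presented := {eq_quot term_equiv_rel}.
HB.instance Definition _ := Choice.on presented.
HB.instance Definition _ := EqQuotient.on presented.

Lemma presentedP t u : \pi_presented t = \pi_presented u <-> term_eq t u.
Proof.
by split=> [/eqquotP/asboolP | tu] //; apply/eqquotP/asboolP.
Qed.

Lemma presented_ind (P : presented -> Prop) :
  (forall t, P (\pi_presented t)) -> forall x, P x.
Proof. by move=> Pt x; rewrite -(reprK x). Qed.

Lemma presented_reprP t : term_eq (repr (\pi_presented t)) t.
Proof. by apply/presentedP; rewrite reprK. Qed.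

Definition pres_add (x y : presented) : presented :=
  \pi_presented (TAdd (repr x) (repr y)).
Definition pres_scale (a : F) (x : presented) : presented :=
  \pi_presented (TScale a (repr x)).
Definition pres_mul (x y : presented) : presented :=
  \pi_presented (TMul (repr x) (repr y)).
Definition pres_gen (g : X) : presented := \pi_presented (TGen g).

Lemma pres_addE t u :
  pres_add (\pi_presented t) (\pi_presented u) = \pi_presented (TAdd t u).
Proof. by apply/presentedP; apply: TeAdd; apply: presented_reprP. Qed.

Lemma pres_scaleE a t :
  pres_scale a (\pi_presented t) = \pi_presented (TScale a t).
Proof. by apply/presentedP; apply: TeScale; apply: presented_reprP. Qed.

Lemma pres_mulE t u :
  pres_mul (\pi_presented t) (\pi_presented u) = \pi_presented (TMul t u).
Proof. by apply/presentedP; apply: TeMul; apply: presented_reprP. Qed.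

Lemma pres_addA : associative pres_add.
Proof.
move=> q; elim/presented_ind: q => t.
move=> q; elim/presented_ind: q => u.
move=> q; elim/presented_ind: q => v.
by rewrite !pres_addE; apply/presentedP/TeAddA.
Qed.

Lemma pres_addC : commutative pres_add.
Proof.
move=> q; elim/presented_ind: q => t.
move=> q; elim/presented_ind: q => u.
by rewrite !pres_addE; apply/presentedP/TeAddC.
Qed.

Lemma pres_add0 : left_id (\pi_presented TZero) pres_add.
Proof.
move=> q; elim/presented_ind: q => t.
by rewrite pres_addE; apply/presentedP/TeAdd0.
Qed.

Lemma pres_addN : left_inverse (\pi_presented TZero) (pres_scale (-1)) pres_add.
Proof.
move=> q; elim/presented_ind: q => t.
rewrite pres_scaleE pres_addE; apply/presentedP.
apply: TeTrans (TeScale0 t); rewrite -(addNr 1).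
apply: TeTrans (TeSym (TeScaleDl _ _ _)); apply: TeAdd; first exact: TeRefl.
exact/TeSym/TeScale1.
Qed.

HB.instance Definition _ :=
  GRing.isZmodule.Build presented pres_addA pres_addC pres_add0 pres_addN.

Lemma presentedD t u :
  \pi_presented (TAdd t u) = \pi_presented t + \pi_presented u.
Proof. by rewrite -pres_addE. Qed.

Lemma pres_scaleA a b x :
  pres_scale a (pres_scale b x) = pres_scale (a * b) x.
Proof.
by elim/presented_ind: x => t; rewrite !pres_scaleE; apply/presentedP/TeScaleA.
Qed.

Lemma pres_scale1 : left_id 1 pres_scale.
Proof.
move=> q; elim/presented_ind: q => t.
by rewrite pres_scaleE; apply/presentedP/TeScale1.
Qed.

Lemma pres_scaleDr : right_distributive pres_scale +%R.
Proof.
move=> a q; elim/presented_ind: q => t.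
move=> q; elim/presented_ind: q => u.
rewrite -(presentedD t u) !pres_scaleE -presentedD.
exact/presentedP/TeScaleDr.
Qed.

Lemma pres_scaleDl x : {morph pres_scale^~ x : a b / a + b}.
Proof.
elim/presented_ind: x => t a b; rewrite !pres_scaleE -presentedD.
exact/presentedP/TeScaleDl.
Qed.

HB.instance Definition _ := GRing.Zmodule_isLmodule.Build F presented
  pres_scaleA pres_scale1 pres_scaleDr pres_scaleDl.

Lemma presentedZ a t : \pi_presented (TScale a t) = a *: \pi_presented t.
Proof. by rewrite -pres_scaleE. Qed.

Lemma pres_mulA : associative pres_mul.
Proof.
move=> q; elim/presented_ind: q => t.
move=> q; elim/presented_ind: q => u.
move=> q; elim/presented_ind: q => v.
by rewrite !pres_mulE; apply/presentedP/TeMulA.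
Qed.

Lemma pres_mulDl : left_distributive pres_mul +%R.
Proof.
move=> q; elim/presented_ind: q => t.
move=> q; elim/presented_ind: q => u.
move=> q; elim/presented_ind: q => v.
rewrite -(presentedD t u) !pres_mulE -presentedD.
exact/presentedP/TeMulDl.
Qed.

Lemma pres_mulDr : right_distributive pres_mul +%R.
Proof.
move=> q; elim/presented_ind: q => t.
move=> q; elim/presented_ind: q => u.
move=> q; elim/presented_ind: q => v.
rewrite -(presentedD u v) !pres_mulE -presentedD.
exact/presentedP/TeMulDr.
Qed.

Lemma pres_mulZl (a : F) (x y : presented) :
  pres_mul (a *: x) y = a *: pres_mul x y.
Proof.
elim/presented_ind: x => t; elim/presented_ind: y => u.
rewrite -(presentedZ a t) !pres_mulE -presentedZ.
exact/presentedP/TeMulZl.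
Qed.

Lemma pres_mulZr (a : F) (x y : presented) :
  pres_mul x (a *: y) = a *: pres_mul x y.
Proof.
elim/presented_ind: x => t; elim/presented_ind: y => u.
rewrite -(presentedZ a u) !pres_mulE -presentedZ.
exact/presentedP/TeMulZr.
Qed.

HB.instance Definition _ := Lmodule_isNUAlgebra.Build F presented
  pres_mulA pres_mulDl pres_mulDr pres_mulZl pres_mulZr.

Lemma presentedM t u :
  \pi_presented (TMul t u) = \pi_presented t ** \pi_presented u.
Proof. by rewrite -pres_mulE. Qed.

End Presentation.

(** * Leavitt path algebras *)

Record digraph := Digraph {
  vertex : Type;
  arrow : Type;
  source : arrow -> vertex;
  target : arrow -> vertex
}.

Inductive lpa_gen (G : digraph) : Type :=
| Vtx of vertex G
| Arr of arrow G
| Star of arrow G.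
Arguments Vtx {G}.
Arguments Arr {G}.
Arguments Star {G}.

Section Leavitt.
Variables (F : fieldType) (G : digraph).
Implicit Types (u v : vertex G) (e f : arrow G).

Let tv v : term F (lpa_gen G) := TGen (Vtx v).
Let ta e : term F (lpa_gen G) := TGen (Arr e).
Let ts e : term F (lpa_gen G) := TGen (Star e).

(* In LpaCK2, r enumerates s^-1(v) without repetition, so the hypotheses say
   that s^-1(v) is finite and nonempty. *)
Inductive lpa_rel : term F (lpa_gen G) -> term F (lpa_gen G) -> Prop :=
| LpaVV v : lpa_rel (TMul (tv v) (tv v)) (tv v)
| LpaUV u v : u <> v -> lpa_rel (TMul (tv u) (tv v)) TZero
| LpaSE e : lpa_rel (TMul (tv (source e)) (ta e)) (ta e)
| LpaET e : lpa_rel (TMul (ta e) (tv (target e))) (ta e)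
| LpaTS e : lpa_rel (TMul (tv (target e)) (ts e)) (ts e)
| LpaSS e : lpa_rel (TMul (ts e) (tv (source e))) (ts e)
| LpaCK1 e : lpa_rel (TMul (ts e) (ta e)) (tv (target e))
| LpaCK1_neq e f : e <> f -> lpa_rel (TMul (ts e) (ta f)) TZero
| LpaCK2 v (r : seq (arrow G)) :
    r <> [::] -> List.NoDup r -> (forall e, List.In e r <-> source e = v) ->
    lpa_rel (tv v) (foldr (fun e => TAdd (TMul (ta e) (ts e))) TZero r).

Definition lpa := presented lpa_rel.

Definition lpa_vtx v : lpa := pres_gen lpa_rel (Vtx v).
Definition lpa_arr e : lpa := pres_gen lpa_rel (Arr e).
Definition lpa_star e : lpa := pres_gen lpa_rel (Star e).

End Leavitt.

(** * Cycles and the subalgebras F[C] *)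

Section Cycles.
Variables (F : fieldType) (G : digraph).
Implicit Types (e : arrow G) (p : seq (arrow G)).

(* The nonempty sequence of arrows e :: p is a path. *)
Fixpoint is_path e p : Prop :=
  if p is f :: q then target e = source f /\ is_path f q else True.

Record graph_cycle := GraphCycle {
  cycle_head : arrow G;
  cycle_tail : seq (arrow G);
  cycle_path : is_path cycle_head cycle_tail;
  cycle_closed : target (last cycle_head cycle_tail) = source cycle_head;
  cycle_distinct : List.NoDup (map (@source G) (cycle_head :: cycle_tail))
}.

Fixpoint path_elt e p : lpa F G :=
  if p is f :: q then lpa_arr F e ** path_elt f q else lpa_arr F e.

Variable C : graph_cycle.

Definition cycle_elt : lpa F G := path_elt (cycle_head C) (cycle_tail C).

Definition cycle_pow (n : nat) : lpa F G :=
  iter n (numul cycle_elt) (lpa_vtx F (source (cycle_head C))).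

(* p |-> p(C), the constant term being read as a multiple of s(C). *)
Definition cycle_eval (p : {poly F}) : lpa F G :=
  \sum_(i < size p) p`_i *: cycle_pow i.

Definition cycle_alg : set (lpa F G) := range cycle_eval.

End Cycles.

(** * Canonical polynomial generators and dlf ideals *)

Section Dlf.
Variables (F : fieldType) (G : digraph) (J : ideal (lpa F G)).

Definition cycle_trace (C : graph_cycle G) : set (lpa F G) :=
  ([set x | J x] `&` cycle_alg C)%classic.

Definition proper_nonzero_trace (C : graph_cycle G) : Prop :=
  cycle_trace C <> cycle_alg C /\ cycle_trace C <> [set 0]%classic.

(* f = f_C : it satisfies f(0) = 1 and generates the ideal of F[x] that
   corresponds to cycle_trace C. *)
Definition canonical_poly (C : graph_cycle G) (f : {poly F}) : Prop :=
  [/\ proper_nonzero_trace C, f.[0] = 1 &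
      forall p : {poly F}, J (cycle_eval C p) <-> f %| p].

(* Linear factors are considered up to nonzero scalars, so each of them is
   normalized to 'X - a%:P. *)
Definition distinct_linear_factors (f : {poly F}) : Prop :=
  exists (c : F) (rs : seq F),
    uniq rs /\ f = c *: \prod_(a <- rs) ('X - a%:P).

Definition dlf : Prop :=
  forall (C : graph_cycle G) (f : {poly F}),
    canonical_poly C f -> distinct_linear_factors f.

End Dlf.

(* Main.v *)
(** Reduction: multiplying a nonzero element of a Leavitt path algebra on both
    sides by suitable elements gives a vertex or a polynomial p(C), p(0) = 1, in
    a cycle C; so a homomorphism that kills none of these is injective.

    (dlf => Leavitt) Modulo J a cycle C with a canonical polynomial has no exit,
    and for distinct roots a Lagrange interpolation at C splits the image of every
    vertex of C into orthogonal idempotents, one for each root a, on which C acts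
    as the scalar a.  The new digraph replaces each vertex of C by these parts,
    drops one arrow of C, and splits off v - sum e e^* at the vertices v where the
    arrows outside J are finitely many but do not satisfy CK2 modulo J.  The map
    from its Leavitt path algebra to the quotient is injective by reduction.

    (Leavitt => dlf) The corner of the quotient at s(C) is F[x]/(f) with f = f_C.
    Let f = z pi with pi irreducible.  Reduction applied to z(C) gives a z(C) b = u
    for a vertex u of the Leavitt path algebra (a polynomial in a cycle would make
    the corner infinite dimensional).  The ideal generated by z in F[x]/(f) is
    simple and contains the nonzero idempotent z(C) b a, hence pi does not divide z.
    By uniqueness of that idempotent no path starting at u branches or closes up;
    hence u L u = F u, the ideal is one-dimensional and pi is linear. *)
Require Import Defs.
From HB Require Import structures.
From Stdlib Require List.
From mathcomp Require Import all_boot all_algebra.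
From mathcomp Require Import boolp classical_sets.

Set Implicit Arguments.
Unset Strict Implicit.
Unset Printing Implicit Defensive.

Import GRing.Theory.
Local Open Scope ring_scope.
Local Open Scope quotient_scope.
Local Open Scope nualg_scope.

(** * Non-unital algebras *)

(** Leavitt path algebras are classes of terms without normal forms, so even a vertex is not
    obviously nonzero. Reduction says nothing about this; an action on functions of boundary paths
    does. There each arrow shifts an integer degree by one, which also separates the powers of a
    closed path. Everything about a cycle with a nonzero relation modulo J rests on C^* C = s(C):
    factors C cancel, so the relation may be taken with constant term 1 and C becomes invertible in
    its corner. This gives e e^* = s(C) for the first arrow e of C, kills every other arrow at C and
    excludes the root 0. In the converse direction an abstract isomorphism says nothing about how
    the vertices of the two digraphs correspond, so the argument is confined to what is visible
    inside F[x]/(f): its dimension and its idempotents. A square factor of f shows up as a nilpotent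
    ideal, which holds no idempotent; a nonlinear irreducible factor shows up as a residue field
    larger than F. *)

Section NUAlgebraTheory.
Variables (F : fieldType) (A : nuAlgType F).
Implicit Types x y z : A.

Lemma numul0l x : 0 ** x = 0.
Proof. by have := numulZl 0 0 x; rewrite !scale0r. Qed.

Lemma numul0r x : x ** 0 = 0.
Proof. by have := numulZr 0 x 0; rewrite !scale0r. Qed.

Lemma numulBl x y z : (x - y) ** z = x ** z - y ** z.
Proof. by rewrite numulDl numulNl. Qed.

Lemma numulBr x y z : z ** (x - y) = z ** x - z ** y.
Proof. by rewrite numulDr numulNr. Qed.

Lemma numul_suml (I : Type) (r : seq I) (P : pred I) (E : I -> A) y :
  (\sum_(i <- r | P i) E i) ** y = \sum_(i <- r | P i) E i ** y.
Proof.
exact: (big_morph (fun x => x ** y) (fun a b => numulDl a b y) (numul0l y)).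
Qed.

Lemma numul_sumr (I : Type) (r : seq I) (P : pred I) (E : I -> A) y :
  y ** (\sum_(i <- r | P i) E i) = \sum_(i <- r | P i) y ** E i.
Proof. exact: (big_morph (numul y) (numulDr y) (numul0r y)). Qed.

End NUAlgebraTheory.

Section PolynomialEvaluation.
Variables (F : fieldType) (A : nuAlgType F).

(* u plays the role of the unit. *)
Definition peval (u x : A) (p : {poly F}) : A :=
  \sum_(i < size p) p`_i *: iter i (numul x) u.

Lemma pevalE u x (p : {poly F}) n : (size p <= n)%N ->
  peval u x p = \sum_(i < n) p`_i *: iter i (numul x) u.
Proof.
move=> le_pn; rewrite /peval.
rewrite (big_ord_widen n (fun i => p`_i *: iter i (numul x) u) le_pn).
rewrite big_mkcond /=; apply: eq_bigr => i _; case: ltnP => // le_pi.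
by rewrite nth_default // scale0r.
Qed.

Lemma pevalD u x p q : peval u x (p + q) = peval u x p + peval u x q.
Proof.
set n := maxn (size p) (size q).
rewrite !(@pevalE u x _ n) ?leq_maxl ?leq_maxr ?size_polyD //.
by rewrite -big_split; apply: eq_bigr => i _; rewrite coefD scalerDl.
Qed.

Lemma pevalZ u x a p : peval u x (a *: p) = a *: peval u x p.
Proof.
rewrite !(@pevalE u x _ (size p)) ?size_scale_leq //.
by rewrite scaler_sumr; apply: eq_bigr => i _; rewrite coefZ scalerA.
Qed.

Lemma pevalB u x p q : peval u x (p - q) = peval u x p - peval u x q.
Proof. by rewrite -scaleN1r pevalD pevalZ scaleN1r. Qed.

Lemma peval0 u x : peval u x 0 = 0.
Proof. by rewrite /peval size_poly0 big_ord0. Qed.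

Lemma peval_sum u x (I : Type) (r : seq I) (P : pred I) (E : I -> {poly F}) :
  peval u x (\sum_(i <- r | P i) E i) = \sum_(i <- r | P i) peval u x (E i).
Proof. exact: (big_morph _ (pevalD u x) (peval0 u x)). Qed.

Lemma pevalXn u x n : peval u x 'X^n = iter n (numul x) u.
Proof.
rewrite (@pevalE u x _ n.+1) ?size_polyXn // big_ord_recr /= big1 ?add0r.
  by rewrite coefXn eqxx scale1r.
by move=> i _; rewrite coefXn (ltn_eqF (ltn_ord i)) scale0r.
Qed.

Lemma pevalC u x a : peval u x a%:P = a *: u.
Proof. by rewrite -[a%:P]mulr1 mul_polyC pevalZ (pevalXn u x 0). Qed.

Lemma peval1 u x : peval u x 1 = u.
Proof. by rewrite (pevalXn u x 0). Qed.

Lemma pevalX u x : x ** u = x -> peval u x 'X = x.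
Proof. by move=> xu; rewrite -['X]expr1 pevalXn /= xu. Qed.

Lemma pevalMX u x p : peval u x ('X * p) = x ** peval u x p.
Proof.
rewrite (@pevalE u x _ (size p).+1); last first.
  by rewrite mulrC (leq_trans (size_polyMleq _ _)) // size_polyX addn2.
rewrite big_ord_recl /= coefXM scale0r add0r numul_sumr.
by apply: eq_bigr => i _; rewrite coefXM /= numulZr.
Qed.

Lemma pevalM u x p q : u ** u = u -> u ** x = x ->
  peval u x (p * q) = peval u x p ** peval u x q.
Proof.
move=> uu ux; elim/poly_ind: p => [|p a IHp].
  by rewrite mul0r !peval0 numul0l.
have uq : u ** peval u x q = peval u x q.
  rewrite numul_sumr; apply: eq_bigr => -[i /= _] _; rewrite numulZr.
  by congr (_ *: _); case: i => //= i; rewrite numulA ux.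
rewrite mulrDl -(mulrC 'X p) -mulrA !pevalD numulDl !pevalMX IHp numulA.
by rewrite mul_polyC pevalZ pevalC numulZl uq.
Qed.

Lemma peval_unitl u x p : u ** u = u -> u ** x = x ->
  u ** peval u x p = peval u x p.
Proof. by move=> uu ux; rewrite -{1}(peval1 u x) -pevalM ?mul1r. Qed.

Lemma peval_unitr u x p : u ** u = u -> u ** x = x ->
  peval u x p ** u = peval u x p.
Proof. by move=> uu ux; rewrite -{2}(peval1 u x) -pevalM ?mulr1. Qed.

(** A commutation relation passes to all powers. It moves p(C) past an arrow onto the rotated cycle,
    and later compares a cycle of the new digraph with the cycle below it. *)
Lemma peval_intertwine u x v z y p : u ** y = y ** v -> x ** y = y ** z ->
  peval u x p ** y = y ** peval v z p.
Proof.
move=> uy xy; rewrite numul_suml numul_sumr; apply: eq_bigr => -[i /= _] _.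
rewrite numulZl numulZr; congr (_ *: _); elim: i => //= i IHi.
by rewrite -numulA IHi !numulA xy.
Qed.

End PolynomialEvaluation.

Lemma peval_morph (F : fieldType) (A B : nuAlgType F) (f : {linear A -> B}) u x p :
  {morph f : x y / x ** y} -> f (peval u x p) = peval (f u) (f x) p.
Proof.
move=> fM; rewrite linear_sum; apply: eq_bigr => -[i /= _] _; rewrite linearZ.
by congr (_ *: _); elim: i => //= i IHi; rewrite fM IHi.
Qed.

Section UniversalProperty.
Variables (F : fieldType) (X : Type) (R : term F X -> term F X -> Prop).
Variables (A : nuAlgType F) (h : X -> A).

Fixpoint teval (t : term F X) : A :=
  match t with
  | TGen g => h g
  | TZero => 0
  | TAdd t u => teval t + teval u
  | TScale a t => a *: teval t
  | TMul t u => teval t ** teval u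
  end.

Hypothesis hR : forall t u, R t u -> teval t = teval u.

Lemma teval_eq t u : term_eq R t u -> teval t = teval u.
Proof.
elim=> //=; clear t u.
- by move=> t u v _ -> _ ->.
- by move=> t t' u u' _ -> _ ->.
- by move=> a t t' _ ->.
- by move=> t t' u u' _ -> _ ->.
- by move=> t u v; rewrite addrA.
- by move=> t u; rewrite addrC.
- by move=> t; rewrite add0r.
- by move=> t; rewrite scale0r.
- by move=> t; rewrite scale1r.
- by move=> a b t; rewrite scalerA.
- by move=> a t u; rewrite scalerDr.
- by move=> a b t; rewrite scalerDl.
- by move=> t u v; rewrite numulA.
- by move=> t u v; rewrite numulDl.
- by move=> t u v; rewrite numulDr.
- by move=> a t u; rewrite numulZl.
- by move=> a t u; rewrite numulZr.
Qed.

Definition pres_lift (x : presented R) : A := teval (repr x).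

Lemma pres_liftE t : pres_lift (\pi_(presented R) t) = teval t.
Proof. exact/teval_eq/presented_reprP. Qed.

Lemma pres_lift_linear : linear pres_lift.
Proof.
move=> a x y; elim/presented_ind: x => t; elim/presented_ind: y => u.
by rewrite -presentedZ -presentedD !pres_liftE.
Qed.

HB.instance Definition _ :=
  GRing.isLinear.Build F (presented R) A _ pres_lift pres_lift_linear.

Lemma pres_liftM : {morph pres_lift : x y / x ** y}.
Proof.
move=> x y; elim/presented_ind: x => t; elim/presented_ind: y => u.
by rewrite -presentedM !pres_liftE.
Qed.

Lemma presented_universal : exists f : {linear presented R -> A},
  {morph f : x y / x ** y} /\ forall g, f (pres_gen R g) = h g.
Proof.
by exists pres_lift; split=> [|g]; [exact: pres_liftM | exact: pres_liftE].
Qed.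

End UniversalProperty.

Lemma presented_alg_ind (F : fieldType) (X : Type)
    (R : term F X -> term F X -> Prop) (P : presented R -> Prop) :
  (forall g, P (pres_gen R g)) -> P 0 ->
  (forall x y, P x -> P y -> P (x + y)) ->
  (forall a x, P x -> P (a *: x)) ->
  (forall x y, P x -> P y -> P (x ** y)) -> forall x, P x.
Proof.
move=> Pg P0 PD PZ PM x; elim/presented_ind: x.
elim=> [g||t Pt u Pu|a t Pt|t Pt u Pu].
- exact: Pg.
- exact: P0.
- by rewrite presentedD; apply: PD.
- by rewrite presentedZ; apply: PZ.
- by rewrite presentedM; apply: PM.
Qed.

Section QuotientMap.
Variables (F : fieldType) (A : nuAlgType F) (J : ideal A).

Definition quot_map (x : A) : quot J := \pi_(quot J) x.

Lemma quot_map_linear : linear quot_map.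
Proof. by move=> a x y; rewrite /quot_map quotD quotZ. Qed.

HB.instance Definition _ :=
  GRing.isLinear.Build F A (quot J) _ quot_map quot_map_linear.

Lemma quot_mapM : {morph quot_map : x y / x ** y}.
Proof. exact: quotM. Qed.

Lemma quot_map_eq0 x : quot_map x = 0 <-> J x.
Proof.
rewrite -(linear0 quot_map) -[in X in _ <-> X](subr0 x); exact: Defs.quotP.
Qed.

End QuotientMap.

(** * Paths in Leavitt path algebras *)

Section LeavittRelations.
Variables (F : fieldType) (G : digraph).
Local Notation L := (lpa F G).
Local Notation vtx := (lpa_vtx F).
Local Notation arr := (lpa_arr F).
Local Notation star := (lpa_star F).
Implicit Types (u v w : vertex G) (e f : arrow G) (p q : seq (arrow G)).

Let relE (t s : term F (lpa_gen G)) : lpa_rel t s ->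
  \pi_(presented (@lpa_rel F G)) t = \pi_(presented (@lpa_rel F G)) s.
Proof. by move=> ts; apply/presentedP/TeRel. Qed.

Lemma vtxvtx v : vtx v ** vtx v = vtx v.
Proof. by rewrite -presentedM; apply/relE/LpaVV. Qed.

Lemma vtxvtx_neq u v : u <> v -> vtx u ** vtx v = 0.
Proof. by move=> uv; rewrite -presentedM; apply/relE/LpaUV. Qed.

Lemma vtxarr e : vtx (source e) ** arr e = arr e.
Proof. by rewrite -presentedM; apply/relE/LpaSE. Qed.

Lemma arrvtx e : arr e ** vtx (target e) = arr e.
Proof. by rewrite -presentedM; apply/relE/LpaET. Qed.

Lemma vtxstar e : vtx (target e) ** star e = star e.
Proof. by rewrite -presentedM; apply/relE/LpaTS. Qed.

Lemma starvtx e : star e ** vtx (source e) = star e.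
Proof. by rewrite -presentedM; apply/relE/LpaSS. Qed.

Lemma stararr e : star e ** arr e = vtx (target e).
Proof. by rewrite -presentedM; apply/relE/LpaCK1. Qed.

Lemma stararr_neq e f : e <> f -> star e ** arr f = 0.
Proof. by move=> ef; rewrite -presentedM; apply/relE/LpaCK1_neq. Qed.

Lemma cuntz_krieger2 v (r : seq (arrow G)) :
  r <> [::] -> List.NoDup r -> (forall e, List.In e r <-> source e = v) ->
  vtx v = \sum_(e <- r) arr e ** star e.
Proof.
move=> r0 ur rP; rewrite /lpa_vtx /pres_gen (relE (LpaCK2 F r0 ur rP)).
elim: r {r0 ur rP} => [|e r IHr] /=; first by rewrite big_nil.
by rewrite presentedD IHr presentedM big_cons.
Qed.

Lemma vtxarr_neq u e : u <> source e -> vtx u ** arr e = 0.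
Proof. by move=> ue; rewrite -vtxarr numulA vtxvtx_neq ?numul0l. Qed.

Lemma starvtx_neq u e : source e <> u -> star e ** vtx u = 0.
Proof. by move=> ue; rewrite -starvtx -numulA vtxvtx_neq ?numul0r. Qed.

Lemma vtxstar_neq u e : u <> target e -> vtx u ** star e = 0.
Proof. by move=> ue; rewrite -vtxstar numulA vtxvtx_neq ?numul0l. Qed.

Fixpoint walk v p w : Prop :=
  if p is e :: q then source e = v /\ walk (target e) q w else v = w.

(** The argument [v] matters only for the empty path, whose value is the vertex itself. *)
Fixpoint pth v p : L := if p is e :: q then arr e ** pth (target e) q else vtx v.

Fixpoint pst v p : L :=
  if p is e :: q then pst (target e) q ** star e else vtx v.

Lemma walk_cat u p q w :
  walk u (p ++ q) w <-> exists2 v, walk u p v & walk v q w.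
Proof.
elim: p u => [|e p IHp] u /=; first by split=> [|[v ->]//]; exists u.
split=> [[<- /IHp[v pv vq]]|[v [-> pv] vq]]; first by exists v.
by split=> //; apply/IHp; exists v.
Qed.

Lemma walk_end v p w w' : walk v p w -> walk v p w' -> w = w'.
Proof. by elim: p v => [|e p IHp] v /= => [-> -> //|[_ /IHp pw] [_ /pw]]. Qed.

Lemma walk_catE u p v q w : walk u p v -> walk u (p ++ q) w -> walk v q w.
Proof. by move=> pv /walk_cat[v' /(walk_end pv) <-]. Qed.

Lemma vtxpth v p w : walk v p w -> vtx v ** pth v p = pth v p.
Proof.
by case: p => [|e p] /= => [_|[<- _]]; rewrite ?vtxvtx // numulA vtxarr.
Qed.

Lemma pthvtx v p w : walk v p w -> pth v p ** vtx w = pth v p.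
Proof.
elim: p v => [|e p IHp] v /= => [->|[_ /IHp pw]]; rewrite ?vtxvtx //.
by rewrite -numulA pw.
Qed.

Lemma vtxpst v p w : walk v p w -> vtx w ** pst v p = pst v p.
Proof.
elim: p v => [|e p IHp] v /= => [->|[_ /IHp pw]]; rewrite ?vtxvtx //.
by rewrite numulA pw.
Qed.

Lemma pstvtx v p w : walk v p w -> pst v p ** vtx v = pst v p.
Proof.
by case: p => [|e p] /= => [_|[<- _]]; rewrite ?vtxvtx // -numulA starvtx.
Qed.

Lemma pth_cat u p v q w : walk u p v -> walk v q w ->
  pth u (p ++ q) = pth u p ** pth v q.
Proof.
move=> + vq; elim: p u => [|e p IHp] u /= => [->|[_ /IHp ->]].
  by rewrite (vtxpth vq).
by rewrite numulA.
Qed.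

Lemma pth1 e : pth (source e) [:: e] = arr e.
Proof. exact: arrvtx. Qed.

Lemma pst1 e : pst (source e) [:: e] = star e.
Proof. exact: vtxstar. Qed.

Lemma pst_pth v p w : walk v p w -> pst v p ** pth v p = vtx w.
Proof.
elim: p v => [|e p IHp] v /= => [->|[_ pw]]; first exact: vtxvtx.
by rewrite numulA -[_ ** arr e]numulA stararr (pstvtx pw) IHp.
Qed.

Lemma pst_pth_cat v p w q w' : walk v p w -> walk w q w' ->
  pst v p ** pth v (p ++ q) = pth w q.
Proof. by move=> pw wq; rewrite (pth_cat pw wq) numulA (pst_pth pw) (vtxpth wq). Qed.

(** CK1 cancels equal arrows one by one: the product dies at the first disagreement, and without one
    the shorter path is a prefix of the longer. *)
Lemma pst_pth_cases v p w u q w' : walk v p w -> walk u q w' ->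
  [\/ pst v p ** pth u q = 0,
      v = u /\ exists r, q = p ++ r | v = u /\ exists r, p = q ++ r].
Proof.
elim: p v u q => [|e p IHp] v u [|f q] /=.
- move=> _ _; case: (pselect (v = u)) => [->|vu]; last by apply: Or31; rewrite vtxvtx_neq.
  by apply: Or32; split=> //; exists [::].
- move=> _ [fu _]; case: (pselect (v = u)) => [->|vu].
    by apply: Or32; split=> //; exists (f :: q).
  by apply: Or31; rewrite numulA vtxarr_neq ?numul0l // fu.
- move=> [ev _] _; case: (pselect (v = u)) => [->|vu].
    by apply: Or33; split=> //; exists (e :: p).
  by apply: Or31; rewrite -numulA starvtx_neq ?numul0r // ev.
move=> [ev ep] [fu fq]; case: (pselect (e = f)) => [ef|ef]; last first.
  by apply: Or31; rewrite numulA -[_ ** arr f]numulA stararr_neq // numul0r numul0l.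
move: fu fq; rewrite -{f}ef => eu eq.
rewrite numulA -[_ ** arr e]numulA stararr (pstvtx ep).
case: (IHp _ _ _ ep eq) => [->|[_ [r ->]]|[_ [r ->]]].
- exact: Or31.
- by apply: Or32; split; [rewrite -ev -eu | exists r].
- by apply: Or33; split; [rewrite -ev -eu | exists r].
Qed.

(* gspan n v: linear span of the p q^* with q of length at most n starting at v. *)
Inductive gspan (n : nat) v : L -> Prop :=
| gspan0 : gspan n v 0
| gspanS (k : F) u p q w x : walk u p w -> walk v q w -> (size q <= n)%N ->
    gspan n v x -> gspan n v (k *: (pth u p ** pst v q) + x).

Lemma gspanD n v x y : gspan n v x -> gspan n v y -> gspan n v (x + y).
Proof.
move=> xP yP; elim: xP => [|k u p q w z pw qw qn _ IH]; first by rewrite add0r.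
by rewrite -addrA; apply: gspanS IH; eassumption.
Qed.

Lemma gspanZ n v a x : gspan n v x -> gspan n v (a *: x).
Proof.
elim=> [|k u p q w z pw qw qn _ IH]; first by rewrite scaler0; left.
by rewrite scalerDr scalerA; apply: gspanS IH; eassumption.
Qed.

Lemma gspan1 n v u p q w : walk u p w -> walk v q w -> (size q <= n)%N ->
  gspan n v (pth u p ** pst v q).
Proof.
move=> pw qw qn; rewrite -[_ ** _]addr0 -[_ ** _]scale1r.
by apply: gspanS (gspan0 n v); eassumption.
Qed.

Lemma gspan_leq m n v x : (m <= n)%N -> gspan m v x -> gspan n v x.
Proof.
move=> mn; elim=> [|k u p q w z pw qw qn _ IH]; first by left.
by apply: gspanS IH; try eassumption; apply: leq_trans mn.
Qed.

(** The arrow cancels the ghost arrow next to it or kills the monomial; a monomial without ghost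
    part grows instead, which suits the truncated [n.-1]. This drop drives the induction in
    [gspan_reducible]. *)
Lemma gspan_arr n e x : gspan n (source e) x -> gspan n.-1 (target e) (x ** arr e).
Proof.
elim=> [|k u p q w z pw qw qn _ IH]; first by rewrite numul0l; left.
rewrite numulDl numulZl; apply: gspanD IH; apply: gspanZ.
case: q qw qn => [|f q] /= => [ew _|[fe qw] qn].
  rewrite -{w}ew in pw; have ee : walk (source e) [:: e] (target e) by [].
  rewrite -numulA vtxarr -(pth1 e) -(pth_cat pw ee).
  have pe : walk u (p ++ [:: e]) (target e) by apply/walk_cat; exists (source e).
  by rewrite -(pthvtx pe); apply: (@gspan1 _ _ _ _ [::]) pe _ _.
rewrite -!numulA; case: (pselect (f = e)) => [fE|/stararr_neq ->].
  rewrite fE stararr -fE (pstvtx qw).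
  by apply: gspan1 pw qw _; case: n qn.
by rewrite !numul0r; left.
Qed.

Lemma gspan_vtx n v u x : gspan n u x -> gspan n v (x ** vtx v).
Proof.
elim=> [|k u' p q w z pw qw qn _ IH]; first by rewrite numul0l; left.
rewrite numulDl numulZl; apply: gspanD IH; apply: gspanZ.
rewrite -numulA -(pstvtx qw) -numulA.
case: (pselect (u = v)) => [<-|/vtxvtx_neq ->]; last by rewrite !numul0r; left.
by rewrite vtxvtx (pstvtx qw); apply: gspan1 pw qw qn.
Qed.

Lemma gspan_star n v e x : gspan n v x -> gspan n.+1 (source e) (x ** star e).
Proof.
elim=> [|k u p q w z pw qw qn _ IH]; first by rewrite numul0l; left.
rewrite numulDl numulZl; apply: gspanD IH; apply: gspanZ.
rewrite -numulA -(pstvtx qw) -numulA.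
case: (pselect (v = target e)) => [ve|/vtxstar_neq ->]; last first.
  by rewrite !numul0r; left.
rewrite ve in qw *.
by rewrite vtxstar; apply: (@gspan1 _ _ _ _ (e :: q)) pw _ _.
Qed.

(** [gspan] fixes the vertex on the right, so a general element needs a finite sum of such pieces at
    several vertices. *)
Inductive mspan : L -> Prop :=
| mspan0 : mspan 0
| mspanS n v x y : gspan n v x -> mspan y -> mspan (x + y).

Lemma mspanD x y : mspan x -> mspan y -> mspan (x + y).
Proof.
elim=> [|n v z t zP _ IH yP]; first by rewrite add0r.
by rewrite -addrA; apply: mspanS zP (IH yP).
Qed.

Lemma mspanZ a x : mspan x -> mspan (a *: x).
Proof.
elim=> [|n v z t zP _ IH]; first by rewrite scaler0; left.
by rewrite scalerDr; apply: mspanS IH; apply: gspanZ zP.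
Qed.

Lemma mspan_gspan n v x : gspan n v x -> mspan x.
Proof. by move=> xP; rewrite -[x]addr0; apply: mspanS xP mspan0. Qed.

Lemma mspan_gen g x : mspan x -> mspan (x ** pres_gen (@lpa_rel F G) g).
Proof.
elim=> [|n v z t zP _ IH]; first by rewrite numul0l; left.
rewrite numulDl; apply: mspanD IH.
case: g => [u|e|e]; [exact: mspan_gspan (gspan_vtx u zP)| |].
  rewrite -/(lpa_arr F e) -vtxarr numulA.
  exact: mspan_gspan (gspan_arr (gspan_vtx _ zP)).
exact: mspan_gspan (gspan_star e zP).
Qed.

(** The right factor is arbitrary: absorbing generators on the right passes to sums and products by
    induction on [y], so no product of two monomials has to be computed. *)
Lemma mspanM x y : mspan x -> mspan (x ** y).
Proof.
move: y x; apply: presented_alg_ind => [g||y z IHy IHz|a y IHy|y z IHy IHz] x xP.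
- exact: mspan_gen.
- by rewrite numul0r; left.
- by rewrite numulDr; apply: mspanD; [apply: IHy | apply: IHz].
- by rewrite numulZr; apply/mspanZ/IHy.
- by rewrite numulA; apply/IHz/IHy.
Qed.

Lemma lpa_mspan x : mspan x.
Proof.
move: x; apply: presented_alg_ind => [g||y z|a y|y z yP _].
- have vP v : mspan (vtx v).
    apply: (@mspan_gspan 0 v); rewrite -vtxvtx.
    exact: (@gspan1 _ _ _ [::] [::]).
  case: g => [v|e|e]; first exact: vP.
    by rewrite -/(lpa_arr F e) -vtxarr; apply: mspanM.
  by rewrite -/(lpa_star F e) -vtxstar; apply: mspanM.
- by left.
- exact: mspanD.
- exact: mspanZ.
- exact: mspanM.
Qed.

Lemma lpa_monomial_ind (P : L -> Prop) :
  P 0 -> (forall x y, P x -> P y -> P (x + y)) ->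
  (forall a x, P x -> P (a *: x)) ->
  (forall u p v q w, walk u p w -> walk v q w -> P (pth u p ** pst v q)) ->
  forall x, P x.
Proof.
move=> P0 Padd PZ Pm x; elim: {x}(lpa_mspan x) => // n v x y xP _ Py.
apply: (Padd) Py; elim: xP => // k u p q w z pw qw _ _ Pz.
by apply: (Padd) Pz; apply: (PZ); apply: Pm qw.
Qed.

(** There is no unit when the digraph has infinitely many vertices, but each element is fixed by a
    finite sum of distinct vertices. The type [{classic vertex G}] supplies the decidable equality
    needed to sum without repetition. *)
Lemma lpa_zero_vtx x : (forall v, x ** vtx v = 0) -> x = 0.
Proof.
move=> x0; suff [s] : exists s : seq {classic vertex G},
    x ** (\sum_(v <- s) vtx v) = x.
  by rewrite numul_sumr big1 // => v _; apply: x0.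
(* Asking for all larger lists makes the claim additive: the lists of two summands can be
   concatenated. *)
suff [s /(_ s) xs] : exists s : seq {classic vertex G}, forall s',
    {subset s <= s'} -> x ** (\sum_(v <- undup s') vtx v) = x.
  by exists (undup s); apply: xs.
move: x {x0}; apply: lpa_monomial_ind => [|x y [s xs] [r yr]|a x [s xs]|u p v q w pw qw].
- by exists [::] => s' _; rewrite numul0l.
- exists (s ++ r) => s' srs'; rewrite numulDl xs ?yr // => z zs; apply: srs'.
    by rewrite mem_cat zs orbT.
  by rewrite mem_cat zs.
- by exists s => s' ss'; rewrite numulZl xs.
exists [:: (v : {classic vertex G})] => s' vs'; rewrite -(pstvtx qw) -!numulA.
rewrite (bigD1_seq (v : {classic vertex G})) ?undup_uniq //=; last first.
  by rewrite mem_undup vs' ?inE.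
rewrite numulDr vtxvtx numul_sumr big1 ?addr0 // => u' /eqP vu'.
by rewrite vtxvtx_neq // => vE; apply: vu'.
Qed.

End LeavittRelations.

Section CyclesAsWalks.
Variables (F : fieldType) (G : digraph).
Local Notation vtx := (lpa_vtx F).
Implicit Types (v w : vertex G) (e : arrow G) (p : seq (arrow G)).

Definition cyc_seq (C : graph_cycle G) := cycle_head C :: cycle_tail C.
Definition cyc_vtx (C : graph_cycle G) := source (cycle_head C).

Lemma is_path_walk e p w :
  is_path e p -> target (last e p) = w -> walk (source e) (e :: p) w.
Proof.
elim: p e => [|f p IHp] e //= [ef fp] pw; split=> //.
by rewrite ef; apply: IHp.
Qed.

Lemma walk_is_path v e p w :
  walk v (e :: p) w -> is_path e p /\ target (last e p) = w.
Proof.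
elim: p e v => [|f p IHp] e v /= [ev] //.
by move=> [fe fp]; have [pf <-] := IHp f (source f) (conj erefl fp).
Qed.

Lemma path_elt_pth e p : is_path e p -> path_elt F e p = pth F (source e) (e :: p).
Proof.
elim: p e => [|f p IHp] e /=; first by rewrite arrvtx.
by move=> [_ fp]; rewrite IHp.
Qed.

Lemma cyc_walk C : walk (cyc_vtx C) (cyc_seq C) (cyc_vtx C).
Proof. exact: is_path_walk (Defs.cycle_path C) (cycle_closed C). Qed.

Lemma cycle_eltE C : cycle_elt F C = pth F (cyc_vtx C) (cyc_seq C).
Proof. exact: path_elt_pth (Defs.cycle_path C). Qed.

Lemma cycle_evalE C (q : {poly F}) :
  cycle_eval C q = peval (vtx (cyc_vtx C)) (pth F (cyc_vtx C) (cyc_seq C)) q.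
Proof. by rewrite -cycle_eltE. Qed.

Lemma cycle_of_walk v p : walk v p v -> p <> [::] ->
  List.NoDup (map (@source G) p) -> exists2 C, cyc_seq C = p & cyc_vtx C = v.
Proof.
case: p => [//|e p] ep _ pN; have [pe pv] := walk_is_path ep.
case: ep => ev _.
by exists (GraphCycle pe (etrans pv (esym ev)) pN).
Qed.

End CyclesAsWalks.

Lemma not_NoDup_map (T U : Type) (f : T -> U) (s : seq T) :
  ~ List.NoDup (map f s) -> exists s1 x s2 y s3,
  s = s1 ++ x :: s2 ++ y :: s3 /\ f x = f y.
Proof.
elim: s => [|x s IHs] /=; first by case; left.
case: (pselect (List.In (f x) (map f s))) => [/List.in_map_iff|xs sN].
  move=> [y [fxy ys]] _; have [s2 [s3 sE]] := List.in_split _ _ ys.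
  by exists [::], x, s2, y, s3; rewrite sE fxy.
have [|s1 [z [s2 [y [s3 [-> fzy]]]]]] := IHs.
  by move=> sN'; apply: sN; constructor.
by exists (x :: s1), z, s2, y, s3.
Qed.

Lemma NoDup_map_cat_cons (T U : Type) (f : T -> U) s1 x s2 y s3 :
  List.NoDup (map f (s1 ++ x :: s2 ++ y :: s3)) -> f x <> f y.
Proof.
elim: s1 => [|z s1 IHs] /= sN; inversion_clear sN; last exact: IHs.
by move=> fxy; apply: H; rewrite fxy map_cat; apply/List.in_app_iff; right; left.
Qed.

(* Both sequences are prefixes of the infinite word s s s ... *)
Lemma commute_prefix_uniq (T : Type) (s t t' u u' : seq T) : s <> [::] ->
  s ++ t = t ++ u -> s ++ t' = t' ++ u' -> size t = size t' -> t = t'.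
Proof.
move=> s0; have s_gt0 : (0 < size s)%N by case: (s) s0.
have [n] := ubnP (size t); elim: n t t' u u' => // n IHn t t' u u' tn tu tu' tt'.
have splitE r q : s ++ r = r ++ q -> (size s <= size r)%N ->
    exists2 r', r = s ++ r' & s ++ r' = r' ++ q.
  move=> rq sr; have rE : r = s ++ drop (size s) r.
    rewrite -[LHS](cat_take_drop (size s)); congr (_ ++ _).
    have := congr1 (take (size s)) rq; rewrite take_size_cat //.
    by rewrite takel_cat // => <-.
  exists (drop (size s) r) => //; rewrite -rE.
  have := congr1 (drop (size s)) rq; rewrite drop_size_cat // => {1}->.
  by rewrite {1}rE -catA drop_size_cat.
have [st|ts] := leqP (size s) (size t); last first.
  have tE r q : s ++ r = r ++ q -> (size r < size s)%N -> r = take (size r) s.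
    move=> rq rs; have := congr1 (take (size r)) rq.
    by rewrite (takel_cat _ (ltnW rs)) (take_size_cat q erefl).
  by rewrite (tE _ _ tu) // (tE _ _ tu') -?tt'.
have [r rE ru] := splitE _ _ tu st.
have [r' rE' ru'] := splitE _ _ tu' (leq_trans st (eq_leq tt')).
rewrite rE rE'; congr (_ ++ _); apply: IHn ru ru' _.
  by move: tn; rewrite rE size_cat ltnS; apply: leq_trans; rewrite -addn1 addnC leq_add2r.
by move: tt'; rewrite rE rE' !size_cat => /addnI.
Qed.

(** * The reduction theorem *)

Section Reduction.
Variables (F : fieldType) (G : digraph).
Local Notation L := (lpa F G).
Local Notation vtx := (lpa_vtx F).
Local Notation arr := (lpa_arr F).
Local Notation star := (lpa_star F).
Implicit Types (u v w : vertex G) (e f : arrow G) (p q : seq (arrow G)).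
Implicit Types (x y : L).

Definition reducible x := exists a b,
  (exists w, a ** x ** b = vtx w) \/
  (exists (C : graph_cycle G) (p : {poly F}),
     p.[0] = 1 /\ a ** x ** b = cycle_eval C p).

Lemma reducible_mul a x b : reducible (a ** x ** b) -> reducible x.
Proof.
move=> [a' [b' xP]]; exists (a' ** a), (b ** b').
by rewrite -!numulA in xP *.
Qed.

Lemma reducible_mull a x : reducible (a ** x) -> reducible x.
Proof.
move=> [a' [b' xP]]; exists (a' ** a), b'.
by rewrite -!numulA in xP *.
Qed.

Lemma reducible_mulr x b : reducible (x ** b) -> reducible x.
Proof.
move=> [a' [b' xP]]; exists a', (b ** b').
by rewrite -!numulA in xP *.
Qed.

(* pspan Q v n: linear combinations of n paths q with source v satisfying Q. *)
Inductive pspan (Q : seq (arrow G) -> Prop) v : nat -> L -> Prop :=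
| pspan0 : pspan Q v 0 0
| pspanS (k : F) q n x : Q q -> pspan Q v n x -> pspan Q v n.+1 (k *: pth F v q + x).

Definition closed_walk v q := walk v q v /\ q <> [::].

Lemma closed_walk_conj v q p w : closed_walk v q -> walk v p w ->
  pst F v p ** pth F v q ** pth F v p = 0 \/
  exists r, [/\ q ++ p = p ++ r, closed_walk w r &
    pst F v p ** pth F v q ** pth F v p = pth F w r].
Proof.
move=> [qv q0] pw; rewrite -numulA -(pth_cat F qv pw).
have qpw : walk v (q ++ p) w by apply/walk_cat; exists v.
case: (pst_pth_cases F pw qpw) => [->|[_ [r qpE]]|[_ [r pE]]]; first by left.
  right; exists r; split=> //.
    rewrite qpE in qpw; split; first exact: walk_catE qpw.
    move=> r0; apply: q0; move/(congr1 size)/eqP: qpE.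
    by rewrite r0 cats0 size_cat -[X in _ == X]add0n eqn_add2r => /nilP.
  rewrite qpE in qpw *; apply: pst_pth_cat => //; exact: walk_catE qpw.
case: q0; move/(congr1 size)/eqP: pE; rewrite !size_cat addnAC.
by rewrite -[X in X == _]add0n eqn_add2r eq_sym addn_eq0 => /andP[/nilP].
Qed.

Lemma pspan_conj v n x p w : pspan (closed_walk v) v n x -> walk v p w ->
  exists2 m, (m <= n)%N & pspan (closed_walk w) w m (pst F v p ** x ** pth F v p).
Proof.
move=> xP pw; elim: xP => [|k q {}n {}x qv _ [m mn mP]].
  by exists 0%N => //; rewrite numul0r numul0l; left.
rewrite numulDr numulDl numulZr numulZl.
case: (closed_walk_conj qv pw) => [->|[r [_ rw ->]]].
  by exists m; [apply: leqW | rewrite scaler0 add0r].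
by exists m.+1 => //; right.
Qed.

(* Every path from v is a prefix of the infinite word q q q ... *)
Definition unavoidable v q :=
  closed_walk v q /\ forall p w, walk v p w -> exists r, q ++ p = p ++ r.

(** If some [q] is avoided by a path [p], then p^* q p = 0 and conjugation by [p] loses that term
    without creating others. So the number of terms can be used for induction. *)
Lemma pspan_conj_or v n x : pspan (closed_walk v) v n x ->
  (exists p w m, [/\ walk v p w, (m < n)%N &
     pspan (closed_walk w) w m (pst F v p ** x ** pth F v p)]) \/
  pspan (unavoidable v) v n x.
Proof.
elim=> [|k q {}n {}x qv xP IH]; first by right; left.
case: (pselect (unavoidable v q)) => [qu|qN].
  case: IH => [[p [w [m [pw mn mP]]]]|IH]; last by right; right.
  left; rewrite /=.
  case: (closed_walk_conj qv pw) => [q0|[r [_ rw rE]]].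
    exists p, w, m; split; rewrite ?ltnS ?(ltnW mn) //.
    by rewrite numulDr numulDl numulZr numulZl q0 scaler0 add0r.
  exists p, w, m.+1; split=> //.
  by rewrite numulDr numulDl numulZr numulZl rE; right.
left; have [p [w [pw pN]]] : exists p w, walk v p w /\ ~ exists r, q ++ p = p ++ r.
  apply: contrapT => pN; apply: qN; split=> // p w pw.
  by apply: contrapT => rN; apply: pN; exists p, w.
have [m mn mP] := pspan_conj xP pw.
exists p, w, m; split=> //.
rewrite numulDr numulDl numulZr numulZl.
case: (closed_walk_conj qv pw) => [->|[r [rE _ _]]]; last by case: pN; exists r.
by rewrite scaler0 add0r.
Qed.

Lemma unavoidable_uniq v q p p' w w' : unavoidable v q ->
  walk v p w -> walk v p' w' -> size p = size p' -> p = p'.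
Proof.
move=> [[_ q0] qu] pw pw'; have [r pr] := qu _ _ pw.
have [r' pr'] := qu _ _ pw'; exact: commute_prefix_uniq pr pr'.
Qed.

(** Paths from [v] are determined by their length, so every nonempty closed path at [v] begins with
    the shortest one. The clause [0 < m] later keeps the constant term of the polynomial under
    control. *)
Lemma unavoidable_cycle v q : unavoidable v q ->
  exists2 C : graph_cycle G, cyc_vtx C = v &
    forall r, walk v r v -> exists m, pth F v r = cycle_pow F C m /\
      (r <> [::] -> (0 < m)%N).
Proof.
move=> qu; have [[qv q0] _] := qu.
pose P n := `[< exists2 c, closed_walk v c & size c = n >].
have exP : exists n, P n by exists (size q); apply/asboolP; exists q.
case: (ex_minnP exP) => n /asboolP[c [cv c0] cn] n_min.
have c_min r : closed_walk v r -> (size c <= size r)%N.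
  by move=> rv; rewrite cn; apply: n_min; apply/asboolP; exists r.
have cN : List.NoDup (map (@source G) c).
  apply: contrapT => cN; have [s1 [e [s2 [f [s3 [cE ef]]]]]] := not_NoDup_map cN.
  (* Cutting out the loop between two equal sources would give a shorter closed path. *)
  have : closed_walk v (s1 ++ f :: s3).
    split; last by case: (s1).
    have := cv; rewrite cE => /walk_cat[u s1u /= [eu]] /walk_cat[u' _ /= [fu' s3v]].
    by apply/walk_cat; exists u => //=; rewrite -ef.
  move/c_min; rewrite cE !size_cat /= size_cat /= leq_add2l addnS ltnS.
  by rewrite -[X in (_ <= X)%N]add0n -addSn leq_add2r.
have [C cE CE] := cycle_of_walk cv c0 cN; exists C => // r.
have [m] := ubnP (size r); elim: m r => // m IHm r rm rv.
case: (pselect (r = [::])) => [->|r0]; first by exists 0%N; rewrite /= -CE.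
have cr := c_min _ (conj rv r0).
have rcv : r = c ++ drop (size c) r.
  rewrite -[LHS](cat_take_drop (size c)); congr (_ ++ _).
  have : walk v (take (size c) r ++ drop (size c) r) v by rewrite cat_take_drop.
  move=> /walk_cat[u ru _]; apply: unavoidable_uniq qu ru cv _.
  by rewrite size_takel.
have dv : walk v (drop (size c) r) v by apply: walk_catE cv _; rewrite -rcv.
have [|k [kE _]] := IHm _ _ dv.
  rewrite size_drop; rewrite ltnS in rm; apply: leq_trans rm.
  by rewrite ltn_subrL; case: (r) (c) r0 c0 => [|? ?] // [].
exists k.+1; split=> //; rewrite rcv (pth_cat F cv dv) kE /cycle_pow /= cycle_eltE.
by rewrite cE CE.
Qed.

Lemma pspan_eval v n x C :
  pspan (unavoidable v) v n x ->
  (forall r, walk v r v -> exists m, pth F v r = cycle_pow F C m /\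
      (r <> [::] -> (0 < m)%N)) ->
  exists2 p : {poly F}, p.[0] = 0 & x = cycle_eval C p.
Proof.
move=> xP CP; elim: xP => [|k q {}n {}x [[qv q0] _] _ [p p0 ->]].
  by exists 0; rewrite ?horner0 // cycle_evalE peval0.
have [m [mE /(_ q0) m0]] := CP _ qv.
exists (k *: 'X^m + p).
  by rewrite hornerD hornerZ hornerXn p0 expr0n gtn_eqF // mulr0 addr0.
by rewrite mE [RHS]pevalD pevalZ pevalXn.
Qed.

(** The shape is stable under conjugation: p^* v p is again a vertex and nonempty closed paths stay
    nonempty, so the term with coefficient [k] can never cancel. *)
Definition leading v x := exists (k : F) n y,
  [/\ k != 0, pspan (closed_walk v) v n y & x = k *: vtx v + y].

(** Conjugation removes closed paths until none is left or all are unavoidable. In the latter case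
    they are powers of one cycle, and dividing by [k] normalizes the constant term. *)
Lemma leading_reducible v x : leading v x -> reducible x.
Proof.
move=> [k [n [y [k0 yP ->]]]]; have [m] := ubnP n.
elim: m v n y yP => // m IHm v n y yP nm.
case: (pspan_conj_or yP) => [[p [w [n' [pw n'n n'P]]]]|yu].
  apply: (@reducible_mul (pst F v p) _ (pth F v p)).
  rewrite numulDr numulDl numulZr numulZl (pstvtx F pw) (pst_pth F pw).
  by apply: IHm n'P _; apply: leq_trans n'n _.
have xP (z : L) : vtx v ** z = z -> z ** vtx v = z ->
    (k^-1 *: vtx v) ** z ** vtx v = k^-1 *: z.
  by move=> vz zv; rewrite -numulA zv numulZl vz.
case: yu => [|a q n' y' qu yu].
  exists (k^-1 *: vtx v), (vtx v); left; exists v.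
  by rewrite addr0 numulZr numulZl xP ?vtxvtx // scalerA divff // scale1r.
have [C CE CP] := unavoidable_cycle qu.
have [p p0 ->] := pspan_eval (pspanS a qu yu) CP.
have -> : k *: vtx v + cycle_eval C p = cycle_eval C (k%:P + p).
  by rewrite !cycle_evalE pevalD pevalC CE.
exists (k^-1 *: vtx v), (vtx v); right; exists C, (k^-1 *: (k%:P + p)).
have cC : walk v (cyc_seq C) v by rewrite -CE; apply: cyc_walk.
rewrite hornerZ hornerD hornerC p0 addr0 mulVf //; split=> //.
rewrite xP !cycle_evalE ?CE ?pevalZ //.
  by apply: peval_unitl; rewrite ?vtxvtx ?(vtxpth F cC).
by apply: peval_unitr; rewrite ?vtxvtx ?(vtxpth F cC).
Qed.

Lemma leading_conj v x p w : leading v x -> walk v p w ->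
  leading w (pst F v p ** x ** pth F v p).
Proof.
move=> [k [n [y [k0 yP ->]]]] pw; have [m _ mP] := pspan_conj yP pw.
exists k, m, (pst F v p ** y ** pth F v p); split=> //.
by rewrite numulDr numulDl numulZr numulZl (pstvtx F pw) (pst_pth F pw).
Qed.

Lemma leading_arr x e : leading (source e) x -> reducible (x ** arr e).
Proof.
have ew : walk (source e) [:: e] (target e) by [].
move=> /leading_conj - /(_ _ _ ew); rewrite pth1 pst1 -numulA.
by move/leading_reducible; apply: reducible_mull.
Qed.

Definition term_path := {classic F * vertex G * seq (arrow G)}%type.

Definition tspan (s : seq term_path) : L :=
  \sum_(i <- s) i.1.1 *: pth F i.1.2 i.2.

Lemma gspan0_tspan v x : gspan 0 v x ->
  exists2 s : seq term_path, {in s, forall i, walk i.1.2 i.2 v} & x = tspan s.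
Proof.
elim=> [|k u p q w y pw qw]; first by exists [::]; rewrite /tspan ?big_nil.
rewrite leqn0 => /nilP qE _ [s sP ->]; move: qw; rewrite {q}qE /= => vw.
rewrite -{w}vw in pw; exists (((k, u, p) : term_path) :: s).
  by move=> i; rewrite inE => /orP[/eqP->|/sP].
by rewrite /tspan big_cons /= (pthvtx F pw).
Qed.

Lemma tspan_pspan v u p (s : seq term_path) : walk u p v ->
  {in s, forall i, [/\ walk i.1.2 i.2 v, (size p <= size i.2)%N & i.1.2 <> u \/ i.2 <> p]} ->
  exists n, pspan (closed_walk v) v n (pst F u p ** tspan s).
Proof.
move=> pv; elim: s => [_|i s IHs sP].
  by exists 0%N; rewrite /tspan big_nil numul0r; left.
have [|n nP] := IHs; first by move=> j js; apply: sP; rewrite inE js orbT.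
have [iv ip iN] := sP i (mem_head _ _).
rewrite /tspan big_cons numulDr numulZr.
case: (pst_pth_cases F pv iv) => [->|[uE [r rE]]|[uE [r rE]]].
- by exists n; rewrite scaler0 add0r.
- have rv : walk v r v by apply: walk_catE pv _; rewrite -rE uE.
  exists n.+1; rewrite -uE rE (pst_pth_cat F pv rv); right=> //; split=> // r0.
  by case: iN; rewrite -?uE // rE r0 cats0.
have r0 : r = [::].
  move: ip; rewrite rE size_cat -[X in (_ <= X)%N]addn0 leq_add2l leqn0.
  by move/nilP.
by case: iN; rewrite -?uE // rE r0 cats0.
Qed.

(** Take a shortest path p of the sum and collect its coefficients. If they cancel, fewer terms
    remain; otherwise p^* turns p into [v] and, as no other path is shorter, each other path into 0
    or a nonempty closed path. *)
Lemma tspan_leading v (s : seq term_path) : {in s, forall i, walk i.1.2 i.2 v} ->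
  tspan s = 0 \/ exists a, leading v (a ** tspan s).
Proof.
have [n] := ubnP (size s); elim: n s => // n IHn s sn sP.
case: (pselect (s = [::])) => [->|s0]; first by left; rewrite /tspan big_nil.
pose P m := has (fun i : term_path => size i.2 == m) s.
have exP : exists m, P m.
  by case: (s) s0 @P => // i s' _; exists (size i.2); rewrite /= eqxx.
case: (ex_minnP exP) => m /hasP[[[k0 u] p] ins /= /eqP pm] m_min.
pose Q (i : term_path) := `[< i.1.2 = u /\ i.2 = p >].
have sE : tspan s = (\sum_(i <- s | Q i) i.1.1) *: pth F u p
    + tspan [seq i <- s | ~~ Q i].
  rewrite {1}/tspan (bigID Q) /= /tspan big_filter scaler_suml; congr (_ + _).
  by apply: eq_bigr => i /asboolP[-> ->].
have s'P : {in [seq i <- s | ~~ Q i], forall i : term_path, walk i.1.2 i.2 v}.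
  by move=> i; rewrite mem_filter => /andP[_ /sP].
case: (eqVneq (\sum_(i <- s | Q i) i.1.1) 0) => [K0|K0].
  rewrite sE K0 scale0r add0r; apply: IHn => //.
  rewrite size_filter; rewrite ltnS in sn; apply: leq_trans sn.
  rewrite -(count_predC Q s) -add1n leq_add2r -has_count.
  by apply/hasP; exists (k0, u, p) => //; apply/asboolP.
right; exists (pst F u p); have pv : walk u p v := sP _ ins.
have [|k kP] := @tspan_pspan v u p [seq i <- s | ~~ Q i] pv.
  move=> i; rewrite mem_filter => /andP[/asboolP iN ins']; split.
  - exact: sP.
  - by rewrite pm; apply: m_min; apply/hasP; exists i.
  - by case: (pselect (i.1.2 = u)) => [iu|]; [right=> ip; apply: iN | left].
exists (\sum_(i <- s | Q i) i.1.1), k, (pst F u p ** tspan [seq i <- s | ~~ Q i]).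
by split=> //; rewrite {1}sE numulDr numulZr (pst_pth F pv).
Qed.

(* The part of positive ghost degree is absorbed by finitely many e e^*. *)
Lemma gspan_split n v x : gspan n v x -> exists y z (l : seq {classic arrow G}),
  [/\ x = y + z, gspan 0 v y, uniq l, {in l, forall e, source e = v} &
      z = z ** \sum_(e <- l) arr e ** star e].
Proof.
have absorb e (l : seq {classic arrow G}) : uniq l -> (e : {classic arrow G}) \in l ->
    star e ** (\sum_(f <- l) arr f ** star f) = star e.
  move=> ul el; rewrite (bigD1_seq (e : {classic arrow G})) //=.
  rewrite numulDr numulA stararr vtxstar numul_sumr big1 ?addr0 // => f /eqP fe.
  by rewrite numulA stararr_neq ?numul0l // => ef; apply: fe.
elim=> [|k u p q w y pw qw qn _ [y' [z [l [-> y'P ul lP zE]]]]].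
  by exists 0, 0, [::]; split; rewrite ?addr0 ?numul0l //; left.
case: q qw qn => [|e q] /= qw _.
  exists (k *: (pth F u p ** vtx v) + y'), z, l; split=> //; first by rewrite addrA.
  by apply: (@gspanS _ _ _ _ k u p [::] w).
have [ev eq] := qw.
exists y', (k *: (pth F u p ** (pst F (target e) q ** star e)) + z).
exists (undup ((e : {classic arrow G}) :: l)).
have el : (e : {classic arrow G}) \in undup ((e : {classic arrow G}) :: l).
  by rewrite mem_undup mem_head.
have lsub (f : {classic arrow G}) : f \in l -> f \in undup ((e : {classic arrow G}) :: l).
  by move=> fl; rewrite mem_undup inE fl orbT.
split=> //; first by rewrite addrCA.
- exact: undup_uniq.
- by move=> f; rewrite mem_undup inE => /orP[/eqP->|/lP].
rewrite numulDl numulZl -!numulA absorb ?undup_uniq //; congr (_ + _).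
rewrite {1}zE [in RHS]zE -numulA; congr (_ ** _).
rewrite numul_suml [LHS]big_seq [RHS]big_seq; apply: eq_bigr => f fl.
by rewrite -numulA absorb ?undup_uniq ?lsub.
Qed.

Lemma In_mem (T : eqType) (s : seq T) (x : T) : List.In x s <-> x \in s.
Proof.
elim: s => //= y s IHs; rewrite inE; split=> [[->|/IHs->]|/orP[/eqP->|/IHs]].
- by rewrite eqxx.
- by rewrite orbT.
- by left.
- by right.
Qed.

Lemma uniq_NoDup (T : eqType) (s : seq T) : uniq s <-> List.NoDup s.
Proof.
elim: s => [|x s IHs] /=; first by split=> // _; constructor.
split=> [/andP[xs /IHs us]|]; first by constructor=> // /In_mem; apply/negP.
by move=> us; inversion_clear us; apply/andP; split; [apply/negP => /In_mem | apply/IHs].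
Qed.

(** If x e is nonzero for some arrow at [v], the ghost length drops. Otherwise x kills all arrows at
    [v], and the finite list [l] of [gspan_split] decides: an arrow outside [l] sees only the
    ghost-free part; if [l] is empty and nothing is outside, x is ghost-free; if [l] is nonempty and
    exhausts the arrows at [v], CK2 gives x = 0. *)
Lemma gspan_reducible n v x : gspan n v x -> x = 0 \/ reducible x.
Proof.
have base w y : gspan 0 w y -> y = 0 \/ exists a, leading w (a ** y).
  by move=> /gspan0_tspan[s sP ->]; apply: tspan_leading.
elim: n v x => [|n IHn] v x xP.
  have [|[a]] := base _ _ xP; [by move=> ->; left | move=> ax; right].
  exact: reducible_mull (leading_reducible ax).
case: (pselect (forall e, source e = v -> x ** arr e = 0)) => [x0|xN]; last first.
  right; have [e [ev xe]] : exists e, source e = v /\ x ** arr e <> 0.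
    apply: contrapT => eN; apply: xN => e ev.
    by apply: contrapT => xe; apply: eN; exists e.
  rewrite -ev in xP; case: (IHn _ _ (gspan_arr xP)) => [/xe[]|].
  exact: reducible_mulr.
have [y [z [l [xE yP ul lP zE]]]] := gspan_split xP.
have xl : x ** (\sum_(e <- l) arr e ** star e) = 0.
  rewrite numul_sumr big_seq big1 // => e el.
  by rewrite numulA x0 ?numul0l // lP.
have xv : x ** vtx v = x.
  elim: {y z l xE yP ul lP zE x0 xl}xP => [|k u p q w y _ qw _ _ IH].
    by rewrite numul0l.
  by rewrite numulDl IH numulZl -numulA (pstvtx F qw).
case: (pselect (exists2 e, source e = v & (e : {classic arrow G}) \notin l)) => [[e ev el]|eN].
  (* The part [z] ends in ghost arrows of [l], all different from [e]. *)
  have xe : x ** arr e = y ** arr e.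
    rewrite xE numulDl zE -numulA numul_suml big_seq big1 ?numul0r ?addr0 // => f fl.
    rewrite -numulA stararr_neq ?numul0r // => fe.
    by rewrite fe in fl; rewrite fl in el.
  have [y0|[a ay]] := base _ _ yP.
    left; move: xl; rewrite xE y0 add0r => zl.
    by rewrite zE zl.
  right; rewrite -ev in ay; have := leading_arr ay.
  by rewrite -numulA -xe => /reducible_mull; apply: reducible_mulr.
case: (pselect (l = [::])) => [l0|l0].
  have xy : x = y by rewrite xE zE l0 big_nil numul0r addr0.
  have [|[a]] := base _ _ yP; rewrite -xy; [by move=> ->; left | move=> ax; right].
  exact: reducible_mull (leading_reducible ax).
left; rewrite -xv (@cuntz_krieger2 F G v l) //; first exact/(@uniq_NoDup {classic arrow G}).
move=> e; split=> [/(@In_mem {classic arrow G})/lP //|ev].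
apply/(@In_mem {classic arrow G}); apply: contrapT => /negP el.
by apply: eN; exists e.
Qed.

Theorem reduction x : x <> 0 -> reducible x.
Proof.
move=> x0; have [v xv] : exists v, x ** vtx v <> 0.
  apply: contrapT => xN; apply: x0; apply: lpa_zero_vtx => v.
  by apply: contrapT => xv; apply: xN; exists v.
apply: (@reducible_mulr _ (vtx v)).
suff [n nP] : exists n, gspan n v (x ** vtx v) by case: (gspan_reducible nP).
elim: (lpa_mspan x) => [|n u y z yP _ [m zm]].
  by exists 0%N; rewrite numul0l; left.
exists (maxn n m); rewrite numulDl; apply: gspanD.
  exact: gspan_leq (leq_maxl _ _) (gspan_vtx v yP).
exact: gspan_leq (leq_maxr _ _) zm.
Qed.

Theorem lpa_injective (A : nuAlgType F) (f : {linear L -> A}) :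
  {morph f : x y / x ** y} -> (forall v, f (vtx v) <> 0) ->
  (forall (C : graph_cycle G) (p : {poly F}), p.[0] = 1 -> f (cycle_eval C p) <> 0) ->
  injective f.
Proof.
move=> fM fv fC x y fxy; apply/eqP; rewrite -subr_eq0; apply/eqP.
apply: contrapT => /reduction[a [b]].
have f0 : f (a ** (x - y) ** b) = 0.
  by rewrite !fM linearB fxy subrr numul0r numul0l.
by case=> [[w wE]|[C [p [p0 pE]]]]; [apply: (fv w) | apply: (fC C p p0)]; rewrite -?wE -?pE.
Qed.

End Reduction.

(** * Representation on boundary paths *)

Section PathRepresentation.
Variables (F : fieldType) (G : digraph).
Local Notation L := (lpa F G).
Local Notation vtx := (lpa_vtx F).
Local Notation arr := (lpa_arr F).
Local Notation star := (lpa_star F).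
Implicit Types (u v w : vertex G) (e f : arrow G) (p q : seq (arrow G)).

(** A preferred outgoing arrow lets finite data encode boundary paths. A path that stops at a vertex
    with finitely many, but some, arrows would violate CK2, hence [nx_regular]. *)
Variable nx : vertex G -> option (arrow G).
Hypothesis nx_source : forall v e, nx v = Some e -> source e = v.
Hypothesis nx_regular : forall v (r : seq (arrow G)), r <> [::] ->
  (forall e, List.In e r <-> source e = v) -> nx v <> None.

(* (v, p, n) stands for the boundary path that follows p from v and then nx for
   ever (or until nx is None), shifted to degree n; no last arrow of p is given
   by nx, so that distinct triples stand for distinct paths. *)
Local Notation point := (vertex G * seq (arrow G) * int)%type.
Implicit Types (x y z : point) (phi psi : point -> F).

Definition starts x v := [/\ x.1.1 = v, exists w, walk v x.1.2 w &
  if x.1.2 is e :: q then nx (source (last e q)) <> Some (last e q) else True].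

(** Removal of the first arrow, provided it is [e]. Behind an empty sequence the first arrow is the
    one prescribed by [nx]. *)
Definition pre e x : option point :=
  match x.1.2 with
  | [::] => if `[< nx x.1.1 = Some e >] then Some (target e, [::], x.2 - 1) else None
  | f :: q => if `[< f = e >] then Some (target e, q, x.2 - 1) else None
  end.

(** The inverse operation; a preferred arrow put before an empty sequence is absorbed, which keeps
    the encoding unique. *)
Definition ext e x : point := (source e,
  if x.1.2 is [::] then if `[< nx (source e) = Some e >] then [::] else [:: e]
  else e :: x.1.2, x.2 + 1).

Lemma ext_starts e x : starts x (target e) -> starts (ext e x) (source e).
Proof.
case: x => [[v [|f q]] n] [/= vE [w ew] xr]; rewrite /starts /ext /=.
  by case: asboolP => /= ne; split=> //; [exists (source e) | exists (target e)].
by split=> //; exists w.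
Qed.

Lemma extK e x : starts x (target e) -> pre e (ext e x) = Some x.
Proof.
case: x => [[v [|f q]] n] [/= vE _ _]; rewrite /pre /ext /=.
  by case: asboolP => /= ne; rewrite ?asboolT ?vE ?addrK.
by rewrite asboolT // vE addrK.
Qed.

Lemma preK e x y : starts x (source e) -> pre e x = Some y ->
  starts y (target e) /\ ext e y = x.
Proof.
case: x => [[v [|f q]] n] [/= vE [w ew] xr]; rewrite /pre /=; case: asboolP => // ne [<-].
  by split; [split=> //; exists (target e) | rewrite /ext /= subrK vE asboolT -?vE].
rewrite {f}ne in ew xr *; split.
  split=> //=; first by exists w; case: ew.
  by case: q xr {ew} => [|f q].
rewrite /ext /= subrK vE; case: q xr {ew} => [|f q] //= xr.
by rewrite asboolF.
Qed.

Lemma pre_inj e f x y z : pre e x = Some y -> pre f x = Some z -> e = f.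
Proof.
case: x => [[v [|g q]] n]; rewrite /pre /=.
  by case: asboolP => // -> _; case: asboolP => // -[->].
by case: asboolP => // -> _; case: asboolP.
Qed.

Lemma pre_regular v (r : seq (arrow G)) x : r <> [::] ->
  (forall e, List.In e r <-> source e = v) -> starts x v ->
  exists2 e, List.In e r & exists y, pre e x = Some y.
Proof.
move=> r0 rP; case: x => [[v' [|f q]] n] [/= -> [w ew] _]; rewrite /pre /=.
  case nv : (nx v) => [e|]; last by case: (nx_regular r0 rP).
  exists e; first exact/rP/nx_source.
  by rewrite asboolT //; eexists.
case: ew => fv _; exists f; first exact/rP.
by rewrite asboolT //; eexists.
Qed.

(** The action is defined on terms because arbitrary operators on functions do not form an algebra:
    right distributivity needs additivity. [tactD] and [tactZ] establish linearity for the operators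
    that occur. *)
Fixpoint tact (t : term F (lpa_gen G)) (phi : point -> F) : point -> F :=
  match t with
  | TGen (Vtx v) => fun x => if `[< starts x v >] then phi x else 0
  | TGen (Arr e) => fun x =>
      if `[< starts x (source e) >] then
        if pre e x is Some y then phi y else 0
      else 0
  | TGen (Star e) => fun x => if `[< starts x (target e) >] then phi (ext e x) else 0
  | TZero => fun=> 0
  | TAdd t u => fun x => tact t phi x + tact u phi x
  | TScale a t => fun x => a * tact t phi x
  | TMul t u => tact t (tact u phi)
  end.

Lemma tactD t phi psi :
  tact t (fun x => phi x + psi x) = (fun x => tact t phi x + tact t psi x).
Proof.
elim: t phi psi => [[v|e|e]||t IHt u IHu|a t IHt|t IHt u IHu] phi psi /=.
- by apply/funext => x; case: ifP; rewrite ?addr0.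
- by apply/funext => x; case: ifP; case: (pre e x); rewrite ?addr0.
- by apply/funext => x; case: ifP; rewrite ?addr0.
- by apply/funext => x; rewrite addr0.
- by apply/funext => x; rewrite IHt IHu addrACA.
- by apply/funext => x; rewrite IHt mulrDr.
- by rewrite IHu IHt.
Qed.

Lemma tactZ t a phi :
  tact t (fun x => a * phi x) = (fun x => a * tact t phi x).
Proof.
elim: t phi => [[v|e|e]||t IHt u IHu|b t IHt|t IHt u IHu] phi /=.
- by apply/funext => x; case: ifP; rewrite ?mulr0.
- by apply/funext => x; case: ifP; case: (pre e x); rewrite ?mulr0.
- by apply/funext => x; case: ifP; rewrite ?mulr0.
- by apply/funext => x; rewrite mulr0.
- by apply/funext => x; rewrite IHt IHu mulrDr.
- by apply/funext => x; rewrite IHt mulrCA.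
- by rewrite IHu IHt.
Qed.

(** CK1 says that an arrow just prepended can be removed and no other can. For CK2, a boundary path
    at a regular vertex begins with exactly one arrow of the list, so a single summand survives. *)
Lemma tact_rel (t s : term F (lpa_gen G)) phi : lpa_rel t s -> tact t phi = tact s phi.
Proof.
have startsU x u' v' : starts x u' -> starts x v' -> u' = v'.
  by move=> [<- _ _] [<- _ _].
case=> [v|u v uv|e|e|e|e|e|e f ef|v r r0 rN rP] /=; apply/funext => x.
- by case: asboolP.
- do 2![case: asboolP => //]; move=> xv xu; by case: uv; apply: startsU xu xv.
- by case: asboolP.
- case: asboolP => // xs; case px : (pre e x) => [y|//].
  by have [yt _] := preK xs px; rewrite asboolT.
- by case: asboolP.
- case: asboolP => // xt; rewrite asboolT //; exact: ext_starts.
- case: asboolP => // xt; rewrite asboolT ?extK //; exact: ext_starts.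
- case: asboolP => // xt; case: asboolP => // _.
  case px : (pre f _) => [y|//].
  by case: ef; apply: pre_inj (extK xt) px.
have sumE (l : seq (arrow G)) : tact (foldr (fun e =>
    TAdd (TMul (TGen (Arr e)) (TGen (Star e)))) TZero l) phi x =
    \sum_(e <- l) tact (TMul (TGen (Arr e)) (TGen (Star e))) phi x.
  by elim: l => [|e l IHl]; rewrite ?big_nil //= IHl big_cons.
rewrite sumE {sumE}.
have termE e : source e = v -> tact (TMul (TGen (Arr e)) (TGen (Star e))) phi x =
    if `[< starts x v /\ exists y, pre e x = Some y >] then phi x else 0.
  move=> ev /=; rewrite ev; case: asboolP => [xv|xN]; last by rewrite asboolF // => -[].
  case px : (pre e x) => [y|]; last by rewrite asboolF // => -[_ [y]].
  rewrite -ev in xv; have [yt yE] := preK xv px.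
  by rewrite asboolT // yE asboolT // -ev; split=> //; exists y.
have {}termE : \sum_(e <- r) tact (TMul (TGen (Arr e)) (TGen (Star e))) phi x =
    \sum_(e <- r) if `[< starts x v /\ exists y, pre e x = Some y >] then phi x else 0.
  have: forall e, List.In e r -> source e = v by move=> e /rP.
  elim: (r) => [|e l IHl] lv; rewrite ?big_nil // !big_cons termE ?IHl //.
    by move=> f fl; apply: lv; right.
  by apply: lv; left.
rewrite termE; case: asboolP => [xv|xN]; last first.
  by rewrite big1 // => e _; rewrite asboolF // => -[].
have [e0 e0r [y0 py0]] := pre_regular r0 rP xv.
have eq_e e : `[< starts x v /\ exists y, pre e x = Some y >] = `[< e = e0 >].
  by apply: asbool_equiv_eq; split=> [[_ [y py]]|->]; [apply: pre_inj py py0 | split=> //; exists y0].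
have r_uniq : \sum_(e <- r) (if `[< e = e0 >] then phi x else 0) = phi x.
  elim: r rN e0r {r0 rP termE} => // e l IHl eN el; rewrite big_cons.
  inversion_clear eN; case: asboolP => [eE|ne].
    apply: (etrans _ (addr0 _)); congr (_ + _).
    have: ~ List.In e0 l by rewrite -eE.
    elim: l {IHl el H H0} => [|f l IHl] fN; rewrite ?big_nil // big_cons IHl.
      by rewrite asboolF ?addr0 // => fe; apply: fN; left.
    by move=> e0s; apply: fN; right.
  by rewrite add0r IHl //; case: el.
by rewrite -[LHS]r_uniq; apply: eq_bigr => e _; rewrite eq_e.
Qed.

Lemma tact_eq t s : term_eq (@lpa_rel F G) t s -> tact t = tact s.
Proof.
elim=> //=; clear t s.
- by move=> t u tu; apply/funext => phi; apply: tact_rel.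
- by move=> t u v _ -> _ ->.
- by move=> t t' u u' _ -> _ ->.
- by move=> a t t' _ ->.
- by move=> t t' u u' _ -> _ ->.
- by move=> t u v; do 2![apply/funext => ?]; rewrite addrA.
- by move=> t u; do 2![apply/funext => ?]; rewrite addrC.
- by move=> t; do 2![apply/funext => ?]; rewrite add0r.
- by move=> t; do 2![apply/funext => ?]; rewrite mul0r.
- by move=> t; do 2![apply/funext => ?]; rewrite mul1r.
- by move=> a b t; do 2![apply/funext => ?]; rewrite mulrA.
- by move=> a t u; do 2![apply/funext => ?]; rewrite mulrDr.
- by move=> a b t; do 2![apply/funext => ?]; rewrite mulrDl.
- by move=> t u v; apply/funext => phi; rewrite tactD.
- by move=> a t u; apply/funext => phi; rewrite tactZ.
Qed.

Definition lact (l : L) : (point -> F) -> point -> F := tact (repr l).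

Lemma lactE t : lact (\pi_(presented (@lpa_rel F G)) t) = tact t.
Proof. exact/tact_eq/presented_reprP. Qed.

Lemma lact0 phi : lact 0 phi = fun=> 0.
Proof. by rewrite -[0 : L]/(\pi_(presented (@lpa_rel F G)) TZero) lactE. Qed.

Lemma lactD l m phi x : lact (l + m) phi x = lact l phi x + lact m phi x.
Proof.
elim/presented_ind: l => t; elim/presented_ind: m => u.
by rewrite -presentedD !lactE.
Qed.

Lemma lactZ a l phi x : lact (a *: l) phi x = a * lact l phi x.
Proof. by elim/presented_ind: l => t; rewrite -presentedZ !lactE. Qed.

Lemma lactM l m phi : lact (l ** m) phi = lact l (lact m phi).
Proof.
elim/presented_ind: l => t; elim/presented_ind: m => u.
by rewrite -presentedM !lactE.
Qed.

Lemma lact_pth v p phi x : lact (pth F v p) phi x <> 0 ->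
  exists y, y.2 = x.2 - (size p)%:Z /\ phi y <> 0.
Proof.
elim: p v x => [|e p IHp] v x /=.
  by rewrite lactE /=; case: ifP => // _ px; exists x; rewrite subr0.
rewrite lactM lactE /=; case: asboolP => // xs.
case px : (pre e x) => [y|//] /IHp[z [zE z0]]; exists z; split=> //.
rewrite zE intS opprD addrA; congr (_ - _).
by have [_ <-] := preK xs px; rewrite /= addrK.
Qed.

Lemma lact_closed_eval v p (q : {poly F}) : walk v p v -> p <> [::] ->
  peval (vtx v) (pth F v p) q = 0 -> q.[0] = 0.
Proof.
(* The test function is the indicator of degree 0, evaluated at a point of degree 0. The i-th power
   of the closed path shifts the degree by [i * size p], so only the constant term contributes. *)
move=> pv p0 /(congr1 lact)/(congr1 (fun g => g (fun x => (x.2 == 0)%:R)))/(congr1 (fun g => g (v, [::], 0))).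
have xv : starts (v, [::], 0) v by split=> //; exists v.
rewrite lact0 horner_coef0 (@pevalE _ _ _ _ _ (size q).+1) //.
have -> : forall n, lact (\sum_(i < n.+1) q`_i *: iter i (numul (pth F v p)) (vtx v))
    (fun x => (x.2 == 0)%:R) (v, [::], 0) = q`_0.
  elim=> [|n IHn]; rewrite big_ord_recr /= lactD lactZ.
    by rewrite big_ord0 lact0 lactE /= asboolT // mulr1 add0r.
  rewrite IHn lactM; set c := lact _ _ _.
  have [->|/eqP c0] := eqVneq c 0; first by rewrite mulr0 addr0.
  have : forall m x, lact (iter m (numul (pth F v p)) (vtx v)) (fun x => (x.2 == 0)%:R) x <> 0 ->
      x.2 = (m * size p)%N%:Z.
    elim=> [|m IHm] x /=.
      by rewrite lactE /=; case: ifP => // _; case: eqP.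
    rewrite lactM => /lact_pth[y [yE /IHm]]; rewrite yE => /eqP.
    by rewrite subr_eq => /eqP->; rewrite mulSn addnC.
  move=> /(_ n.+1) /=; rewrite lactM => /(_ _ c0) /= /eqP.
  by rewrite eq_sym eqz_nat muln_eq0 /= => /nilP.
by [].
Qed.

Lemma lact_vtx v : vtx v <> 0.
Proof.
move/(congr1 lact)/(congr1 (fun g => g (fun=> 1) (v, [::], 0))).
rewrite lact0 lactE /= asboolT; last by split=> //; exists v.
by move/eqP; rewrite oner_eq0.
Qed.

End PathRepresentation.

Section Independence.
Variables (F : fieldType) (G : digraph).

Lemma special_arrows : exists nx : vertex G -> option (arrow G),
  (forall v e, nx v = Some e -> source e = v) /\
  (forall v (r : seq (arrow G)), r <> [::] ->
    (forall e, List.In e r <-> source e = v) -> nx v <> None).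
Proof.
have /choice[nx nxP] : forall v, exists o : option (arrow G),
    if o is Some e then source e = v else ~ exists e, source e = v.
  move=> v; case: (pselect (exists e, source e = v)) => [[e ev]|eN].
    by exists (Some e).
  by exists None.
exists nx; split=> [v e nv|v r r0 rP nv]; first by have := nxP v; rewrite nv.
have := nxP v; rewrite nv; apply; case: r r0 rP {nv} => // e r _ rP.
by exists e; apply/rP; left.
Qed.

Lemma vtx_neq0 (v : vertex G) : lpa_vtx F v <> 0.
Proof. by have [nx [nx_s nx_r]] := special_arrows; apply: (lact_vtx nx_s nx_r). Qed.

(** The constant term vanishes by the degree argument; then p^* p = v cancels one factor of the
    closed path and the degree of [q] drops. *)
Lemma closed_walk_independent (v : vertex G) p (q : {poly F}) :
  walk v p v -> p <> [::] -> peval (lpa_vtx F v) (pth F v p) q = 0 -> q = 0.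
Proof.
have [nx [nx_s nx_r]] := special_arrows.
move=> pv p0; have [n] := ubnP (size q); elim: n q => // n IHn q qn qE.
have q00 := lact_closed_eval nx_s nx_r pv p0 qE.
have : root q 0 by apply/rootP.
case/factor_theorem=> r rE; rewrite subr0 mulrC in rE.
apply/eqP; apply: contraT => q0.
have r0 : r != 0 by apply: contraNneq q0 => rz; rewrite rE rz mulr0.
suff : r = 0 by move/eqP; rewrite (negPf r0).
apply: IHn; first by move: qn; rewrite rE mulrC size_mulX.
move: qE; rewrite rE pevalMX => /(congr1 (numul (pst F v p))).
rewrite numul0r numulA (pst_pth F pv) peval_unitl ?vtxvtx ?(vtxpth F pv) //.
Qed.

End Independence.

(** * Cycles whose powers are dependent in a quotient *)

Section CycleEvaluation.
Variables (F : fieldType) (G : digraph).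
Local Notation L := (lpa F G).
Local Notation vtx := (lpa_vtx F).
Local Notation arr := (lpa_arr F).
Local Notation star := (lpa_star F).
Implicit Types (C : graph_cycle G) (p q : {poly F}).

Definition cyc_pth C : L := pth F (cyc_vtx C) (cyc_seq C).
Definition cyc_pst C : L := pst F (cyc_vtx C) (cyc_seq C).

Lemma cycle_evalM C p q : cycle_eval C (p * q) = cycle_eval C p ** cycle_eval C q.
Proof.
rewrite !cycle_evalE; apply: pevalM; first exact: vtxvtx.
exact: vtxpth (cyc_walk C).
Qed.

Lemma cycle_eval1 C : cycle_eval C 1 = vtx (cyc_vtx C).
Proof. by rewrite cycle_evalE peval1. Qed.

Lemma cycle_evalX C : cycle_eval C 'X = cyc_pth C.
Proof. by rewrite cycle_evalE pevalX // (pthvtx F (cyc_walk C)). Qed.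

Lemma cycle_evalD C p q : cycle_eval C (p + q) = cycle_eval C p + cycle_eval C q.
Proof. by rewrite !cycle_evalE pevalD. Qed.

Lemma cycle_evalB C p q : cycle_eval C (p - q) = cycle_eval C p - cycle_eval C q.
Proof. by rewrite !cycle_evalE pevalB. Qed.

Lemma cycle_evalZ C a p : cycle_eval C (a *: p) = a *: cycle_eval C p.
Proof. by rewrite !cycle_evalE pevalZ. Qed.

Lemma cycle_eval0 C : cycle_eval C (0 : {poly F}) = 0.
Proof. by rewrite !cycle_evalE peval0. Qed.

Lemma cyc_pst_pth C : cyc_pst C ** cyc_pth C = vtx (cyc_vtx C).
Proof. exact: pst_pth (cyc_walk C). Qed.

Lemma cycle_eval_vtxl C p : vtx (cyc_vtx C) ** cycle_eval C p = cycle_eval C p.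
Proof. by rewrite -cycle_eval1 -cycle_evalM mul1r. Qed.

Lemma cycle_eval_vtxr C p : cycle_eval C p ** vtx (cyc_vtx C) = cycle_eval C p.
Proof. by rewrite -cycle_eval1 -cycle_evalM mulr1. Qed.

Lemma cycle_eval_eq0 C p : cycle_eval C p = 0 -> p = 0.
Proof. rewrite cycle_evalE; exact: closed_walk_independent (cyc_walk C) _. Qed.

Lemma cycle_rot C : exists C', cyc_vtx C' = target (cycle_head C) /\
  cyc_seq C' = rcons (cycle_tail C) (cycle_head C).
Proof.
have [hv tw] := cyc_walk C; set e := cycle_head C in hv tw *.
have rw : walk (target e) (rcons (cycle_tail C) e) (target e).
  by rewrite -cats1; apply/walk_cat; exists (cyc_vtx C).
have rN : List.NoDup (map (@source G) (rcons (cycle_tail C) e)).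
  have := cycle_distinct C; rewrite map_rcons -cats1 /= -/e => dN.
  inversion_clear dN; apply/(@uniq_NoDup {classic vertex G}).
  rewrite cats1 rcons_uniq; apply/andP; split; last exact/(@uniq_NoDup {classic vertex G}).
  by apply/negP => /(@In_mem {classic vertex G}).
have [|C' CE Cv] := cycle_of_walk rw _ rN; last by exists C'.
by case: (cycle_tail C).
Qed.

End CycleEvaluation.

Section BadCycles.
Variables (F : fieldType) (G : digraph) (A : nuAlgType F).
Variable psi : {linear lpa F G -> A}.
Hypothesis psiM : {morph psi : x y / x ** y}.
Local Notation L := (lpa F G).
Local Notation vtx := (lpa_vtx F).
Local Notation arr := (lpa_arr F).
Local Notation star := (lpa_star F).
Local Notation cyc_pth := (cyc_pth F).
Local Notation cyc_pst := (cyc_pst F).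
Implicit Types (C : graph_cycle G) (e : arrow G) (v w : vertex G).

(* For psi the projection modulo J, these are the cycles C for which the trace
   of J on F[C] is proper and nonzero. *)
Definition bad_cycle C := psi (vtx (cyc_vtx C)) <> 0 /\
  exists2 p : {poly F}, p <> 0 & psi (cycle_eval C p) = 0.

Lemma psi_eval_root0 C p : psi (cycle_eval C ('X * p)) = 0 -> psi (cycle_eval C p) = 0.
Proof.
rewrite cycle_evalM cycle_evalX => /(congr1 (numul (psi (cyc_pst C)))).
by rewrite -psiM numulA cyc_pst_pth cycle_eval_vtxl numul0r.
Qed.

(** Factors x of a kernel polynomial cancel through C^* C = s(C); what remains has a nonzero
    constant term and can be normalized. The relation makes -r(C) an inverse of C in the image of
    F[C]. *)
Lemma bad_cycle_unit C : bad_cycle C -> exists r : {poly F},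
  psi (cycle_eval C (1 + 'X * r)) = 0.
Proof.
move=> [v0 [p]]; have [n] := ubnP (size p); elim: n p => // n IHn p pn p0 pE.
have [p00|p00] := eqVneq p.[0] 0.
  have /factor_theorem[q qE] : root p 0 by apply/rootP.
  rewrite subr0 mulrC in qE.
  have q0 : q != 0 by apply/eqP => q0; apply: p0; rewrite qE q0 mulr0.
  apply: (IHn q); [|exact/eqP|].
    by move: pn; rewrite qE mulrC size_mulX.
  by apply: psi_eval_root0; rewrite -qE.
have /factor_theorem[q] : root (p.[0]^-1 *: p - 1) 0.
  by apply/rootP; rewrite hornerD hornerN hornerZ hornerC mulVf // subrr.
rewrite subr0 mulrC => /eqP; rewrite subr_eq addrC => /eqP qE.
by exists q; rewrite -qE cycle_evalZ linearZ /= pE scaler0.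
Qed.

(** The element u = v - C C^* satisfies u C = 0, so multiplying the relation v + C r(C) = 0 by u
    leaves u = 0. *)
Lemma bad_cycle_CCstar C : bad_cycle C ->
  psi (cyc_pth C ** cyc_pst C) = psi (vtx (cyc_vtx C)).
Proof.
move=> /bad_cycle_unit[r]; rewrite cycle_evalD cycle_eval1 cycle_evalM cycle_evalX => rE.
apply/eqP; rewrite eq_sym -subr_eq0 -linearB; apply/eqP.
set u := vtx _ - _; have uv : u ** vtx (cyc_vtx C) = u.
  by rewrite numulBl vtxvtx -numulA (pstvtx F (cyc_walk C)).
have uC : u ** cyc_pth C = 0.
  rewrite numulBl (vtxpth F (cyc_walk C)) -numulA cyc_pst_pth.
  by rewrite (pthvtx F (cyc_walk C)) subrr.
rewrite -uv -[RHS](numul0r (psi u)) -rE -psiM numulDr numulA uC numul0l addr0.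
by rewrite uv.
Qed.

(** For the first arrow e, e e^* fixes C C^* on the left, and C C^* is already the whole vertex. *)
Lemma bad_cycle_head C : bad_cycle C ->
  psi (arr (cycle_head C) ** star (cycle_head C)) = psi (vtx (cyc_vtx C)).
Proof.
move=> Cb; rewrite -(bad_cycle_CCstar Cb).
have -> : cyc_pth C ** cyc_pst C =
    arr (cycle_head C) ** star (cycle_head C) ** (cyc_pth C ** cyc_pst C).
  have [_ tw] := cyc_walk C.
  rewrite /cyc_pth /= -!numulA [in RHS](numulA (star _)) stararr.
  by rewrite [in RHS](numulA (vtx _)) (vtxpth F tw).
by rewrite [RHS]psiM (bad_cycle_CCstar Cb) -psiM -numulA starvtx.
Qed.

Lemma bad_cycle_exit_head C e : bad_cycle C -> source e = cyc_vtx C ->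
  e <> cycle_head C -> psi (arr e) = 0.
Proof.
move=> Cb ev eh; rewrite -vtxarr ev psiM -(bad_cycle_head Cb) -psiM -numulA.
by rewrite stararr_neq ?numul0r ?linear0 // => he; apply: eh.
Qed.

Lemma cycle_eval_rot C C' p : cyc_vtx C' = target (cycle_head C) ->
  cyc_seq C' = rcons (cycle_tail C) (cycle_head C) ->
  cycle_eval C p ** arr (cycle_head C) = arr (cycle_head C) ** cycle_eval C' p.
Proof.
move=> Cv CE; rewrite !cycle_evalE; apply: peval_intertwine.
  by rewrite Cv arrvtx vtxarr.
have [_ tw] := cyc_walk C; rewrite CE Cv /= -numulA -cats1; congr (_ ** _).
have ew : walk (cyc_vtx C) [:: cycle_head C] (target (cycle_head C)) by [].
by rewrite (pth_cat F tw ew) /= arrvtx.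
Qed.

Lemma bad_cycle_rot C C' : cyc_vtx C' = target (cycle_head C) ->
  cyc_seq C' = rcons (cycle_tail C) (cycle_head C) ->
  bad_cycle C -> bad_cycle C'.
Proof.
move=> Cv CE [v0 [p p0 pE]]; split.
  move=> t0; apply: v0; have eE : psi (arr (cycle_head C)) = 0.
    by rewrite -arrvtx psiM -Cv t0 numul0r.
  by rewrite -cyc_pst_pth psiM /cyc_pth /= psiM eE numul0l numul0r.
exists p => //; rewrite -cycle_eval_vtxl Cv -stararr -numulA -cycle_eval_rot //.
by rewrite !psiM pE numul0l numul0r.
Qed.

Lemma bad_cycle_rot_eval C C' p : cyc_vtx C' = target (cycle_head C) ->
  cyc_seq C' = rcons (cycle_tail C) (cycle_head C) -> bad_cycle C ->
  psi (cycle_eval C p) = 0 <-> psi (cycle_eval C' p) = 0.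
Proof.
move=> Cv CE Cb; split=> pE.
  rewrite -cycle_eval_vtxl Cv -stararr -numulA -cycle_eval_rot //.
  by rewrite !psiM pE numul0l numul0r.
rewrite -cycle_eval_vtxr psiM -(bad_cycle_head Cb) -psiM numulA.
by rewrite (cycle_eval_rot p Cv CE) !psiM pE numul0r numul0l.
Qed.

Lemma bad_cycle_exit C l1 e l2 f : bad_cycle C -> cyc_seq C = l1 ++ e :: l2 ->
  source f = source e -> f <> e -> psi (arr f) = 0.
Proof.
elim: l1 C l2 => [|a l1 IHl] C l2 Cb CE fe nfe.
  by case: CE => hE tE; apply: (bad_cycle_exit_head Cb); rewrite /cyc_vtx hE.
have [C' [Cv' CE']] := cycle_rot C.
have Cb' := bad_cycle_rot Cv' CE' Cb.
apply: (IHl C' (rcons l2 a)) => //; rewrite CE'.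
by case: CE => -> ->; rewrite rcons_cat.
Qed.

(** Arrows leaving the cycle die in the image, so a path that starts on the cycle either dies or
    follows it. The prefix [l1] is carried along to allow induction on [l2]. *)
Lemma bad_cycle_prefix C l1 l2 (p : seq (arrow G)) v w : bad_cycle C -> cyc_seq C = l1 ++ l2 ->
  walk v l2 (cyc_vtx C) -> walk v p w ->
  [\/ psi (pth F v p) = 0, exists p', p = l2 ++ p' |
      exists l3, l3 <> [::] /\ l2 = p ++ l3].
Proof.
elim: l2 l1 p v => [|e l2 IHl] l1 p v Cb CE lv pv.
  by apply: Or32; exists p.
case: p pv => [_|f p /= [fv pv]]; first by apply: Or33; exists (e :: l2).
case: lv => ev lv; case: (pselect (f = e)) => [fe|nfe]; last first.
  apply: Or31; rewrite psiM (@bad_cycle_exit C l1 e l2 f) ?numul0l //.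
  by rewrite fv.
rewrite {f}fe in fv pv *.
have [|p0|[p' ->]|[l3 [l30 ->]]] := IHl (rcons l1 e) p _ Cb _ lv pv.
- by rewrite cat_rcons.
- by apply: Or31; rewrite psiM p0 numul0r.
- by apply: Or32; exists p'.
- by apply: Or33; exists l3.
Qed.

Lemma bad_cycle_closed C (p : seq (arrow G)) : bad_cycle C -> walk (cyc_vtx C) p (cyc_vtx C) ->
  psi (pth F (cyc_vtx C) p) = 0 \/
  exists k, pth F (cyc_vtx C) p = cycle_eval C 'X^k.
Proof.
move=> Cb; have [n] := ubnP (size p); elim: n p => // n IHn p pn pv.
case: (pselect (p = [::])) => [->|p0].
  by right; exists 0%N; rewrite cycle_eval1.
have [|[p' pE]|[l3 [l30 CE]]] := bad_cycle_prefix (l1 := [::]) Cb erefl (cyc_walk C) pv.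
- by left.
- have p'v : walk (cyc_vtx C) p' (cyc_vtx C).
    by apply: walk_catE (cyc_walk C) _; rewrite -pE.
  rewrite pE (pth_cat F (cyc_walk C) p'v) psiM.
  have [|->|[k ->]] := IHn p' _ p'v.
  + move: pn; rewrite pE /= size_cat ltnS; apply: leq_trans.
    by rewrite ltnS leq_addl.
  + by left; rewrite numul0r.
  + by right; exists k.+1; rewrite exprS cycle_evalM cycle_evalX.
have := cycle_distinct C; rewrite -/(cyc_seq C) CE.
case: p p0 {pn} pv CE => // e p _ pv CE; case: l3 l30 CE => // f l3 _ CE CN.
case: (@NoDup_map_cat_cons _ _ (@source G) [::] e p f l3 CN); case: (pv) => -> _.
have := cyc_walk C; rewrite CE => /(walk_catE pv) /= [-> _] //.
Qed.

Lemma bad_cycle_uniq C C2 : bad_cycle C -> cyc_vtx C2 = cyc_vtx C ->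
  cyc_seq C2 = cyc_seq C.
Proof.
move=> Cb C2v; have w2 := cyc_walk C2; rewrite C2v in w2.
have noret D (l : seq (arrow G)) : walk (cyc_vtx C) l (cyc_vtx C) -> l <> [::] ->
    cyc_vtx D = cyc_vtx C -> forall l', cyc_seq D = l ++ l' -> l' = [::].
  move=> lv l0 Dv [//|f l'] DE; have := cycle_distinct D; rewrite -/(cyc_seq D) DE.
  case: l l0 lv DE => // e l _ lv DE DN.
  case: (@NoDup_map_cat_cons _ _ (@source G) [::] e l f l' DN); case: (lv) => -> _.
  by have := cyc_walk D; rewrite Dv DE => /(walk_catE lv) /= [-> _].
have [C20|[p' pE]|[l3 [l30 CE]]] :=
  bad_cycle_prefix (l1 := [::]) Cb erefl (cyc_walk C) w2.
- case: Cb.1; rewrite -(pst_pth F w2).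
  by rewrite psiM C20 numul0r.
- have p'0 : p' = [::] by apply: noret (cyc_walk C) _ C2v _ pE.
  by rewrite pE p'0 cats0.
- by case: l30; apply: (noret C) w2 _ _ _ CE.
Qed.

Lemma bad_cycle_star C : bad_cycle C -> exists s : {poly F},
  psi (cyc_pst C) = psi (cycle_eval C s).
Proof.
move=> /bad_cycle_unit[r]; rewrite cycle_evalD cycle_eval1 cycle_evalM cycle_evalX.
move=> /(congr1 (numul (psi (cyc_pst C)))); rewrite -psiM numul0r numulDr numulA.
rewrite (pstvtx F (cyc_walk C)) cyc_pst_pth cycle_eval_vtxl linearD => /eqP.
rewrite addr_eq0 => /eqP ->; exists (- r).
by rewrite -[- r]scaleN1r cycle_evalZ linearZ /= scaleN1r.
Qed.

Lemma cycle_pow_pth C n : exists p, [/\ cycle_eval C 'X^n = pth F (cyc_vtx C) p,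
  walk (cyc_vtx C) p (cyc_vtx C) & (n <= size p)%N].
Proof.
elim: n => [|n [p [pE pv np]]]; first by exists [::]; rewrite cycle_eval1.
exists (cyc_seq C ++ p); split.
- by rewrite exprS cycle_evalM cycle_evalX pE (pth_cat F (cyc_walk C) pv).
- by apply/walk_cat; exists (cyc_vtx C) => //; exact: cyc_walk.
- by rewrite size_cat /= ltnS (leq_trans np) // leq_addl.
Qed.

(** To remove the ghost part of a monomial p q^*, insert v as the n-th power of C times the n-th
    power of C^*, with n the length of q. That power of C is long enough to absorb q^*, and C^* is
    itself a polynomial in C. *)
Lemma bad_cycle_corner C x : bad_cycle C -> exists s : {poly F},
  psi (vtx (cyc_vtx C) ** x ** vtx (cyc_vtx C)) = psi (cycle_eval C s).
Proof.
move=> Cb; set v := cyc_vtx C.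
move: x; apply: lpa_monomial_ind => [|x y [s sE] [t tE]|a x [s sE]|u p u' q w pw qw].
- by exists 0; rewrite numul0r numul0l cycle_eval0.
- by exists (s + t); rewrite numulDr numulDl cycle_evalD !linearD /= sE tE.
- by exists (a *: s); rewrite numulZr numulZl cycle_evalZ !linearZ /= sE.
have zero : psi 0 = psi (cycle_eval C 0) by rewrite cycle_eval0.
case: (pselect (v = u)) => [vu|nu]; last first.
  by exists 0; rewrite -(vtxpth F pw) !numulA vtxvtx_neq ?numul0l.
case: (pselect (u' = v)) => [u'v|nu]; last first.
  by exists 0; rewrite -(pstvtx F qw) -!numulA vtxvtx_neq ?numul0r.
rewrite -{u}vu in pw *; rewrite {u'}u'v in qw *.
rewrite -[vtx v ** _ ** _]numulA -[_ ** _ ** vtx v]numulA (pstvtx F qw).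
rewrite numulA (vtxpth F pw).
have [s sE] := bad_cycle_star Cb.
have [c [cE cv qc]] := cycle_pow_pth C (size q).
have yE : psi (pth F v p ** pst F v q) =
    psi (pth F v p ** (pst F v q ** pth F v c)) ** psi (cycle_eval C (s ^+ size q)).
  rewrite -cE -psiM -!numulA -cycle_evalM -exprMn_comm; last exact: mulrC.
  have -> : psi (pth F v p ** pst F v q) = psi (pth F v p ** (pst F v q ** vtx v)).
    by rewrite (pstvtx F qw).
  rewrite !psiM; congr (_ ** (_ ** _)); elim: (size q) => [|n IHn].
    by rewrite cycle_eval1.
  rewrite exprS cycle_evalM psiM -IHn cycle_evalM cycle_evalX psiM -sE.
  by rewrite -psiM (bad_cycle_CCstar Cb) -psiM vtxvtx.
suff [t tE] : exists t : {poly F},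
    psi (pth F v p ** (pst F v q ** pth F v c)) = psi (cycle_eval C t).
  by exists (t * s ^+ size q); rewrite yE tE -psiM -cycle_evalM.
have [[r [rw rE]]|->] : (exists r, walk w r v /\ pst F v q ** pth F v c = pth F w r) \/
    pst F v q ** pth F v c = 0.
- case: (pst_pth_cases F qw cv) => [->|[_ [r cr]]|[_ [r qr]]]; first by right.
    left; exists r; have rw : walk w r v by apply: walk_catE qw _; rewrite -cr.
    by rewrite cr; split=> //; exact: (pst_pth_cat F qw rw).
  have r0 : r = [::].
    move: qc; rewrite qr size_cat -[X in (_ <= X)%N]addn0 leq_add2l leqn0.
    by move/nilP.
  left; exists [::]; rewrite r0 cats0 in qr; rewrite -qr; split.
    by apply: walk_catE qw _; rewrite cats0 qr.
  by rewrite (pst_pth F qw).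
- rewrite rE -(pth_cat F pw rw).
  have pr : walk v (p ++ r) v by apply/walk_cat; exists w.
  case: (bad_cycle_closed Cb pr) => [->|[k ->]]; last by exists 'X^k.
  by exists 0; rewrite cycle_eval0 linear0.
- by exists 0; rewrite numul0r cycle_eval0.
Qed.

End BadCycles.

(** * Quotients that are Leavitt path algebras are dlf *)

Section LinearFactors.
Variable F : fieldType.
Implicit Types f z pi : {poly F}.

Lemma irreducible_factor f : (1 < size f)%N ->
  exists2 pi, irreducible_poly pi & pi %| f.
Proof.
have [n] := ubnP (size f); elim: n f => // n IHn f fn f1.
case: (pselect (irreducible_poly f)) => [fi|fN]; first by exists f.
have [q [q1 qf nqf]] : exists q : {poly F}, [/\ size q != 1%N, q %| f & ~~ (q %= f)].
  apply: contrapT => qN; apply: fN; split=> // q q1 qf.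
  by apply: contrapT => /negP nqf; apply: qN; exists q.
have f0 : f != 0 by rewrite -size_poly_gt0 ltnW.
have q0 : q != 0 by apply: contraTneq qf => ->; rewrite dvd0p.
have qn : (size q < n)%N.
  rewrite ltnS in fn; apply: leq_trans fn; rewrite ltn_neqAle dvdp_leq // andbT.
  by rewrite dvdp_size_eqp.
have [|pi pii piq] := IHn q qn; first by rewrite ltn_neqAle eq_sym q1 size_poly_gt0.
by exists pi => //; apply: dvdp_trans qf.
Qed.

(** Roots are split off one at a time; the clause [~~ (pi %| z)] keeps a root already taken out of
    the cofactor. *)
Lemma distinct_linear_factorsP f : f != 0 ->
  (forall z pi, f = z * pi -> irreducible_poly pi ->
    (exists c, pi %| 'X - c%:P) /\ ~~ (pi %| z)) ->
  distinct_linear_factors f.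
Proof.
have [n] := ubnP (size f); elim: n f => // n IHn f fn f0 fP.
have [f1|f1] := leqP (size f) 1.
  by exists f`_0, [::]; rewrite big_nil -mul_polyC mulr1 -size1_polyC.
have [pi pii /dvdpP[z fE]] := irreducible_factor f1.
have [[c pic] _] := fP _ _ fE pii.
have /dvdpP[y yE] : 'X - c%:P %| f.
  rewrite fE dvdp_mull //.
  have [pi1 _] := pii; have := irredp_XsubC c => -[_ /(_ pi _ pic)].
  by rewrite gtn_eqF // => /(_ isT); rewrite eqp_sym => /eqp_dvdl->.
have y0 : y != 0 by apply: contraNneq f0 => y0; rewrite yE y0 mul0r.
have [_ cy] := fP _ _ yE (irredp_XsubC c).
have [|||k [rs [rsU yR]]] := IHn y.
- by move: fn; rewrite yE size_Mmonic ?monicXsubC // size_XsubC addn2.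
- exact: y0.
- move=> w rho wE rhoi; have [|rho1 rho2] := fP (w * ('X - c%:P)) rho _ rhoi.
    by rewrite yE wE mulrAC.
  by split=> //; apply: contraNN rho2; apply: dvdp_mulr.
exists k, (c :: rs); rewrite big_cons yE yR mulrC scalerAr; split=> //=.
rewrite rsU andbT; apply: contraNN cy => crs.
rewrite dvdp_XsubCl yR; apply/rootP; rewrite hornerZ (rootP _) ?mulr0 //.
by rewrite root_prod_XsubC.
Qed.

End LinearFactors.

(** * A corner of a Leavitt path algebra isomorphic to F[x]/(f) *)

Section PolynomialCorner.
Variables (F : fieldType) (M : digraph) (f : {poly F}).
(** With the hypotheses below, [E] induces an isomorphism from F[x]/(f) onto the corner of the
    idempotent [E 1]. *)
Variable E : {linear {poly F} -> lpa F M}.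
Hypothesis f_neq0 : f != 0.
Hypothesis EM : {morph E : p q / p * q >-> p ** q}.
Hypothesis EP : forall p : {poly F}, E p = 0 <-> f %| p.
Hypothesis corner : forall y, exists s : {poly F}, E 1 ** y ** E 1 = E s.
Local Notation vtx := (lpa_vtx F).
Local Notation arr := (lpa_arr F).
Local Notation star := (lpa_star F).
Implicit Types (u w : vertex M) (p q : seq (arrow M)) (a b y : lpa F M).

Let E1l (p : {poly F}) : E 1 ** E p = E p. Proof. by rewrite -EM mul1r. Qed.

Let E1r (p : {poly F}) : E p ** E 1 = E p. Proof. by rewrite -EM mulr1. Qed.

(* The corner of E 1 is F[x]/(f), too small to contain the powers of a closed path. *)
Let no_closed_walk z a b u p (q : {poly F}) : walk u p u -> p <> [::] -> q != 0 ->
  a ** E z ** b <> peval (vtx u) (pth F u p) q.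
Proof.
move=> pu p0 q0 qE; pose R := peval (vtx u) (pth F u p).
have RM r s : R (r * s) = R r ** R s.
  by apply: pevalM; [exact: vtxvtx | exact: vtxpth pu].
have /choice[r rP] : forall k : nat, exists s : {poly F},
    E z ** b ** R 'X^k ** a ** E z = E s.
  move=> k; have [s sE] := corner (E z ** b ** R 'X^k ** a ** E z).
  by exists s; rewrite -sE !numulA E1l -(numulA _ (E z) (E 1)) E1r.
pose d := size f.
(* One more row than columns: the remainders modulo [f] of [d.+1] polynomials are dependent, and a
   left kernel vector gives the coefficients of [s]. *)
pose T : 'M[F]_(d.+1, d) := \matrix_(k < d.+1, j < d) (r k %% f)`_j.
have : kermx T != 0.
  rewrite kermx_eq0 /row_free; apply: contraTneq (rank_leq_col T) => ->.
  by rewrite ltnn.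
case/rowV0Pn=> c /sub_kermxP cT c0.
pose s : {poly F} := \sum_(k < d.+1) c 0 k *: 'X^k.
have s0 : s != 0.
  apply: contra_neq c0 => s0; apply/rowP => k; rewrite mxE.
  have := congr1 (fun t : {poly F} => t`_k) s0; rewrite coef0 coef_sum => <-.
  rewrite (bigD1 k) //= coefZ coefXn eqxx mulr1 big1 ?addr0 // => j jk.
  by rewrite coefZ coefXn eq_sym -[_ == _]/(j == k) (negPf jk) mulr0.
have fs : f %| \sum_(k < d.+1) c 0 k *: r k.
  rewrite /dvdp (big_morph _ (modpD f) (mod0p f)); apply/eqP/polyP => j; rewrite coef0 coef_sum.
  have [jd|dj] := ltnP j d; last first.
    rewrite big1 // => k _; rewrite modpZl coefZ nth_default ?mulr0 //.
    by apply: leq_trans dj; rewrite ltnW // ltn_modp.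
  have := congr1 (fun t : 'rV[F]_d => t 0 (Ordinal jd)) cT; rewrite !mxE => cT0.
  by rewrite -[RHS]cT0; apply: eq_bigr => k _; rewrite modpZl coefZ mxE.
have sE : E z ** b ** R s ** a ** E z = 0.
  rewrite /R peval_sum numul_sumr !numul_suml -[RHS]((EP _).2 fs).
  rewrite linear_sum; apply: eq_bigr => k _.
  by rewrite pevalZ linearZ /= numulZr !numulZl -/(R _) rP.
(* Sandwiching [R s] between two copies of [R q], that is of a E(z) b, exposes the vanishing factor,
   although [q * s * q] is nonzero. *)
have : R (q * s * q) = 0.
  rewrite !RM -[R q]qE.
  have -> : a ** E z ** b ** R s ** (a ** E z ** b) =
      a ** (E z ** b ** R s ** a ** E z) ** b by rewrite !numulA.
  by rewrite sE numul0r numul0l.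
move/(closed_walk_independent pu p0)/eqP.
by rewrite !mulf_eq0 (negPf q0) (negPf s0).
Qed.

Variables (z pi : {poly F}).
Hypotheses (fE : f = z * pi) (pi_irr : irreducible_poly pi).

Let z_neq0 : z != 0.
Proof. by apply: contraNneq f_neq0 => z0; rewrite fE z0 mul0r. Qed.

Let EzP (p : {poly F}) : E (z * p) = 0 <-> pi %| p.
Proof. by rewrite -(dvdp_mul2l _ _ z_neq0) -fE; apply: EP. Qed.

Let pi_prime (p q : {poly F}) : ~~ (pi %| p) -> pi %| p * q -> pi %| q.
Proof. by move=> pip; rewrite Gauss_dvdpr // irreducible_poly_coprime. Qed.

(** Under these equations E(z) b a is an idempotent equivalent to the vertex [u], which is how [u]
    becomes visible in the corner. *)
Let corner_vertex u a b :=
  [/\ a ** E z ** b = vtx u, vtx u ** a = a & b ** vtx u = b].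

Let corner_vertex_exists : exists u a b, corner_vertex u a b.
Proof.
have /reduction[a [b [[u uE]|[D [q [q0 qE]]]]]] : E z <> 0.
- rewrite -[z]mulr1 EzP dvdp1 => /eqP pi1.
  by case: pi_irr; rewrite pi1.
- exists u, (vtx u ** a), (b ** vtx u); split.
  + by rewrite -!numulA !(numulA a) !(numulA _ b) uE !vtxvtx.
  + by rewrite numulA vtxvtx.
  + by rewrite -numulA vtxvtx.
case: (@no_closed_walk z a b _ _ q (cyc_walk D)) => //.
  by apply: contra_eq_neq q0 => ->; rewrite horner0 eq_sym oner_eq0.
by rewrite qE cycle_evalE.
Qed.

Let corner_vertex_walk u a b p w : corner_vertex u a b -> walk u p w ->
  corner_vertex w (pst F u p ** a) (b ** pth F u p).
Proof.
move=> [uE ua bu] pw; split.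
- rewrite -!numulA (numulA a) (numulA _ b) uE (vtxpth F pw).
  exact: pst_pth pw.
- by rewrite numulA (vtxpst F pw).
- by rewrite -numulA (pthvtx F pw).
Qed.

Let corner_vertex_acyclic u a b p : corner_vertex u a b -> walk u p u -> p = [::].
Proof.
move=> [uE _ _] pu; apply: contrapT => p0.
by apply: (@no_closed_walk z a b _ _ 1 pu p0); rewrite ?oner_eq0 // peval1.
Qed.

(** Idempotence says that [pi] divides h (z h - 1); if [pi] divided [h], the idempotent and with it
    the vertex [u] would vanish. *)
Let corner_idempotent u a b : corner_vertex u a b ->
  exists2 h : {poly F}, E z ** b ** a ** E 1 = E (z * h) & pi %| z * h - 1.
Proof.
move=> [uE ua bu]; have [h hE] := corner (b ** a).
have gE : E z ** b ** a ** E 1 = E (z * h).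
  by rewrite EM -hE !numulA E1r.
exists h => //.
have aZb : a ** (E z ** b) = vtx u by rewrite numulA.
have idem : E (z * h) ** E (z * h) = E (z * h).
  rewrite -gE -!numulA (numulA (E 1)) E1l (numulA a (E z)).
  by rewrite (numulA (a ** E z) b) uE (numulA (vtx u)) ua.
have hz : ~~ (pi %| h).
  apply/negP => /EzP zh0; apply: (@vtx_neq0 F M u).
  have <- : a ** (E z ** b ** a ** E 1) ** (E z ** b) = vtx u.
    by rewrite -!numulA (numulA (E 1)) E1l (numulA a _ b) uE bu aZb.
  by rewrite gE zh0 numul0r numul0l.
apply: (pi_prime hz); apply/EzP.
by rewrite mulrBr mulr1 mulrBr mulrA linearB /= EM idem subrr.
Qed.

Let pi_ndiv1 : ~~ (pi %| 1).
Proof. by rewrite dvdp1 neq_ltn; case: pi_irr => ->; rewrite orbT. Qed.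

Let pi_ndiv_z u a b : corner_vertex u a b -> ~~ (pi %| z).
Proof.
move=> /corner_idempotent[h _]; apply: contraL => piz.
by rewrite dvdp_subr ?dvdp_mulr ?pi_ndiv1.
Qed.

(* E z generates a simple ideal of the commutative corner, so it contains a
   single nonzero idempotent. *)
Let corner_idempotent_uniq u a b u' a' b' :
  corner_vertex u a b -> corner_vertex u' a' b' ->
  E z ** b ** a ** E 1 = E z ** b' ** a' ** E 1.
Proof.
move=> ab ab'; have [h -> hP] := corner_idempotent ab.
have [h' -> hP'] := corner_idempotent ab'.
apply/eqP; rewrite -subr_eq0 -linearB -mulrBr; apply/eqP/EzP.
apply: (pi_prime (pi_ndiv_z ab)).
have -> : z * (h - h') = (z * h - 1) - (z * h' - 1) by rewrite mulrBr opprB addrA subrK.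
exact: dvdp_sub.
Qed.

(** Moving along [e] gives a second corner vertex with the same idempotent. Sandwiched between [a]
    and [E z ** b], the equality of idempotents becomes e e^* = u. *)
Let corner_vertex_ck2 u a b e : corner_vertex u a b -> source e = u ->
  arr e ** star e = vtx u.
Proof.
move=> ab eu; have eP : walk u [:: e] (target e) by [].
have [aZb ua bu] := ab.
have := corner_idempotent_uniq (corner_vertex_walk ab eP) ab.
have aZbY y : a ** (E z ** (b ** y)) = vtx u ** y by rewrite !numulA aZb.
rewrite -eu pth1 pst1 eu => /(congr1 (fun y => a ** y ** (E z ** b))).
rewrite -!numulA (numulA (E 1)) E1l (numulA a (E z) b) aZb !aZbY -eu starvtx vtxvtx.
by rewrite numulA vtxarr.
Qed.

Let corner_vertex_walks u a b p q w : corner_vertex u a b ->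
  walk u p w -> walk u q w -> pth F u p ** pst F u q = vtx u.
Proof.
elim: p u q a b => [|e p IHp] u [|g q] a b ab.
- by move=> _ _; rewrite /= vtxvtx.
- by move=> /= <- gq; have := @corner_vertex_acyclic _ _ _ (g :: q) ab gq.
- by move=> + /= uw; rewrite -uw => ep; have := @corner_vertex_acyclic _ _ _ (e :: p) ab ep.
move=> [eu ep] [gu gq]; have eg : e = g.
  apply: contrapT => eg; apply: (@vtx_neq0 F M (target e)).
  rewrite -(stararr F e) -{1}starvtx eu -(corner_vertex_ck2 ab gu).
  by rewrite (numulA (star e)) stararr_neq ?numul0l.
rewrite -{g}eg in gu gq *; have ew : walk u [:: e] (target e) by [].
have IH := IHp _ _ _ _ (corner_vertex_walk ab ew) ep gq.
rewrite /= -!numulA (numulA (pth F _ _)) IH vtxstar.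
exact: corner_vertex_ck2 ab eu.
Qed.

Let corner_vertex_scalar u a b y : corner_vertex u a b ->
  exists c : F, vtx u ** y ** vtx u = c *: vtx u.
Proof.
move=> ab; move: y.
apply: lpa_monomial_ind => [|x y [c cE] [d dE]|k x [c cE]|v p v' q w pw qw].
- by exists 0; rewrite numul0r numul0l scale0r.
- by exists (c + d); rewrite numulDr numulDl cE dE scalerDl.
- by exists (k * c); rewrite numulZr numulZl cE scalerA.
case: (pselect (u = v)) => [uv|nu]; last first.
  by exists 0; rewrite -(vtxpth F pw) !numulA vtxvtx_neq ?numul0l // scale0r.
case: (pselect (v' = u)) => [v'u|nu]; last first.
  by exists 0; rewrite -(pstvtx F qw) -!numulA vtxvtx_neq ?numul0r // scale0r.
rewrite -{v}uv in pw *; rewrite {v'}v'u in qw *; exists 1.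
by rewrite (corner_vertex_walks ab pw qw) !vtxvtx scale1r.
Qed.

(** Compressing [E 'X] by the idempotent E(z h) lands in a copy of F u and so gives a scalar [c].
    Since z h is 1 modulo [pi], this reads x = c modulo [pi]. *)
Lemma corner_linear_factor : (exists c, pi %| 'X - c%:P) /\ ~~ (pi %| z).
Proof.
have [u [a [b ab]]] := corner_vertex_exists; split; last exact: pi_ndiv_z ab.
have [h hE hP] := corner_idempotent ab; have [uE ua bu] := ab.
have [c cE] := corner_vertex_scalar (a ** E 'X ** (E z ** b)) ab.
exists c; have zh_c : E (z * (h * ('X * (z * h) - c%:P))) = 0.
  have -> : z * (h * ('X * (z * h) - c%:P)) = z * h * 'X * (z * h) - c *: (z * h).
    by rewrite mulrA mulrBr (mulrC _ c%:P) mul_polyC (mulrA (z * h) 'X).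
  rewrite linearB linearZ /= EM [E (z * h * 'X)]EM -hE; apply/eqP; rewrite subr_eq0; apply/eqP.
  have {}cE : a ** (E 'X ** (E z ** b)) = c *: vtx u.
    by rewrite -cE -!numulA (numulA (vtx u)) ua bu.
  have -> : E z ** b ** a ** E 1 ** E 'X ** (E z ** b ** a ** E 1) =
      E z ** (b ** (a ** (E 'X ** (E z ** b)) ** (a ** E 1))).
    by rewrite -!numulA (numulA (E 1)) E1l.
  by rewrite cE numulZl !numulZr (numulA (vtx u)) ua !numulA.
have hN : ~~ (pi %| h).
  by apply: contraL hP => pih; rewrite dvdp_subr ?dvdp_mull ?pi_ndiv1.
have := pi_prime hN ((EzP _).1 zh_c) => piX.
have -> : 'X - c%:P = ('X * (z * h) - c%:P) - 'X * (z * h - 1).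
  by rewrite mulrBr mulr1 opprB [RHS]addrC addrA subrK.
by rewrite dvdp_sub ?dvdp_mull.
Qed.

End PolynomialCorner.

Lemma corner_distinct_linear_factors (F : fieldType) (M : digraph) (f : {poly F})
    (E : {linear {poly F} -> lpa F M}) :
  f != 0 -> {morph E : p q / p * q >-> p ** q} ->
  (forall p : {poly F}, E p = 0 <-> f %| p) ->
  (forall y, exists s : {poly F}, E 1 ** y ** E 1 = E s) ->
  distinct_linear_factors f.
Proof.
move=> f0 EM EP Ec; apply: distinct_linear_factorsP => // z pi fE pii.
exact: (corner_linear_factor f0 EM EP Ec fE pii).
Qed.

Section CycleEvalLinear.
Variables (F : fieldType) (G : digraph) (C : graph_cycle G).

Lemma cycle_eval_linear : linear (@cycle_eval F G C).
Proof. by move=> a p q; rewrite cycle_evalD cycle_evalZ. Qed.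

HB.instance Definition _ := GRing.isLinear.Build F {poly F} (lpa F G) _
  (@cycle_eval F G C) cycle_eval_linear.

End CycleEvalLinear.

Lemma leavitt_quotient_dlf (F : fieldType) (G M : digraph) (J : ideal (lpa F G)) :
  nualg_isomorphic (quot J) (lpa F M) -> dlf J.
Proof.
move=> [phi [phiM phi_bij]] C f [_ f0 fP].
have f_neq0 : f != 0.
  by apply: contra_eq_neq f0 => ->; rewrite horner0 eq_sym oner_eq0.
pose psi : {linear lpa F G -> lpa F M} := phi \o quot_map J.
have psiM : {morph psi : x y / x ** y} by move=> x y; rewrite /= quot_mapM phiM.
have psi0 x : psi x = 0 <-> J x.
  rewrite -quot_map_eq0; split=> [|x0]; last by rewrite /= x0 linear0.
  by move=> px; apply: (bij_inj phi_bij); rewrite linear0.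
have EP (p : {poly F}) : psi (cycle_eval C p) = 0 <-> f %| p.
  by rewrite psi0; apply: fP.
(* A constant has the empty list of roots; for any other [f] the vertex s(C) survives, so the cycle
   is bad. *)
have [f1|f1] := leqP (size f) 1.
  by exists f`_0, [::]; rewrite big_nil -mul_polyC mulr1 -size1_polyC.
have f_bad : bad_cycle psi C.
  split; last by exists f; [exact/eqP | exact/EP].
  rewrite -cycle_eval1 => /EP; rewrite dvdp1 => /eqP fs.
  by rewrite fs in f1.
apply: (@corner_distinct_linear_factors F M f (psi \o @cycle_eval F G C)) => //.
  by move=> p q; rewrite /= cycle_evalM quot_mapM phiM.
move=> y; have [x <-] : exists x, psi x = y.
  have [psi' _ phiK] := phi_bij; exists (repr (psi' y)).
  by rewrite /= /quot_map reprK phiK.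
have [s sE] := bad_cycle_corner psiM x f_bad.
by exists s; rewrite -[RHS]/(psi (cycle_eval C s)) -sE !psiM -cycle_eval1.
Qed.

(** * The digraph of a dlf quotient *)

Lemma In_map (T U : Type) (f : T -> U) (s : seq T) y :
  List.In y (map f s) <-> exists x, f x = y /\ List.In x s.
Proof. exact: List.in_map_iff. Qed.

Section Lagrange.
Variable F : fieldType.
Implicit Types (rs : seq F) (a b : F).

Definition lagrange rs a : {poly F} :=
  \prod_(b <- rs | b != a) ((a - b)^-1 *: ('X - b%:P)).

Lemma lagrange_self rs a : (lagrange rs a).[a] = 1.
Proof.
rewrite horner_prod big1 // => b ba.
by rewrite hornerZ hornerXsubC mulVf // subr_eq0 eq_sym.
Qed.

Lemma lagrange_other rs a b : b \in rs -> b != a -> (lagrange rs a).[b] = 0.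
Proof.
move=> brs ba; rewrite horner_prod (big_rem b) //= ba.
by rewrite hornerZ hornerXsubC subrr mulr0 mul0r.
Qed.

Lemma all_root_prod_XsubC rs (p : {poly F}) : uniq rs ->
  all (root p) rs = (\prod_(a <- rs) ('X - a%:P) %| p).
Proof.
move=> rsU; apply/idP/idP => [pr|/dvdpP[q ->]].
  by apply: uniq_roots_dvdp => //; rewrite uniq_rootsE.
by apply/allP => a ars; rewrite rootM root_prod_XsubC ars orbT.
Qed.

End Lagrange.

Lemma big_dep_pairs (V : nmodType) (S T : eqType) (l : seq S) (t : S -> seq T)
    (r : seq (S * T)) (E : S -> T -> V) :
  uniq l -> (forall x, uniq (t x)) -> uniq r ->
  (forall x y, ((x, y) \in r) = (x \in l) && (y \in t x)) ->
  \sum_(z <- r) E z.1 z.2 = \sum_(x <- l) \sum_(y <- t x) E x y.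
Proof.
move=> lU tU rU rE.
have rl : perm_eq r [seq (x, y) | x <- l, y <- t x].
  apply: uniq_perm => //.
    by apply: allpairs_uniq_dep => // -[x y] [x' y'] _ _ [-> ->].
  move=> [x y]; rewrite rE; apply/andP/allpairsPdep => [[xl yt]|]; first by exists x, y.
  by move=> [x' [y' [xl yt [-> ->]]]].
by rewrite (perm_big _ rl) big_allpairs_dep.
Qed.

Section SplitQuotient.
Variables (F : fieldType) (G : digraph) (A : nuAlgType F).
Variable psi : {linear lpa F G -> A}.
Hypothesis psiM : {morph psi : x y / x ** y}.
Hypothesis psi_surj : forall y, exists x, psi x = y.
Local Notation vtx := (lpa_vtx F).
Local Notation arr := (lpa_arr F).
Local Notation star := (lpa_star F).
Local Notation cyc_pth := (cyc_pth F).
Local Notation cyc_pst := (cyc_pst F).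
Implicit Types (C : graph_cycle G) (u v w : vertex G) (e : arrow G) (a b : F).

(** For distinct roots divisibility by the product of the linear factors is vanishing on [rs], so
    identities in the image of F[C] can be checked by values at the roots. *)
Definition annihilator_roots C (rs : seq F) := uniq rs /\
  forall p : {poly F}, psi (cycle_eval C p) = 0 <-> all (root p) rs.

Definition live v := psi (vtx v) <> 0.

Definition out_ck2 v (l : seq {classic arrow G}) := [/\ uniq l, l <> [::] &
  forall e, (e : {classic arrow G}) \in l <-> source e = v /\ live (target e)].

(* Choices: for every vertex on a bad cycle, that cycle and its roots; for every
   vertex v violating CK2 in the image, the list of its live arrows; and a point
   in every nonempty set of vertices. *)
Variable bad_at : vertex G -> option (graph_cycle G * seq F).
Hypothesis bad_atS : forall v C rs, bad_at v = Some (C, rs) ->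
  [/\ bad_cycle psi C, cyc_vtx C = v & annihilator_roots C rs].
Hypothesis bad_atN : forall v, bad_at v = None ->
  forall C, cyc_vtx C = v -> ~ bad_cycle psi C.
Variable break_at : vertex G -> option (seq {classic arrow G}).
Hypothesis break_atS : forall v l, break_at v = Some l -> out_ck2 v l /\
  \sum_(e <- l) psi (arr e ** star e) <> psi (vtx v).
Hypothesis break_atN : forall v, break_at v = None -> forall l, out_ck2 v l ->
  \sum_(e <- l) psi (arr e ** star e) = psi (vtx v).
Variable point_of : (vertex G -> Prop) -> option (vertex G).
Hypothesis point_ofP : forall P : vertex G -> Prop, (exists v, P v) ->
  exists2 v, point_of P = Some v & P v.

(** Off the bad cycles the labels are mere tags: 0 for the part from which arrows start, 1 for the
    complement of sum e e^*, which becomes a sink. *)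
Definition labels v : seq F :=
  if bad_at v is Some (_, rs) then rs
  else if break_at v is Some _ then [:: 0; 1] else [:: 0].

(* The image of v is the sum of the orthogonal idempotents part v a, a in labels v. *)
Definition part v a : A :=
  if bad_at v is Some (C, rs) then psi (cycle_eval C (lagrange rs a))
  else if break_at v is Some l then
    let s := \sum_(e <- l) psi (arr e ** star e) in
    if a == 0 then s else psi (vtx v) - s
  else psi (vtx v).

Lemma live_source e : live (target e) -> live (source e).
Proof.
move=> te se; apply: te.
by rewrite -stararr -vtxarr !psiM se numul0l numul0r.
Qed.

Lemma dead_arr e : ~ live (target e) -> psi (arr e) = 0.
Proof. by move=> /contrapT te; rewrite -arrvtx psiM te numul0r. Qed.

Lemma dead_star e : ~ live (target e) -> psi (star e) = 0.
Proof. by move=> /contrapT te; rewrite -vtxstar psiM te numul0l. Qed.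

Lemma eval_congr C rs (p q : {poly F}) : annihilator_roots C rs ->
  {in rs, forall a, p.[a] = q.[a]} ->
  psi (cycle_eval C p) = psi (cycle_eval C q).
Proof.
move=> [_ rsP] pq; apply/eqP; rewrite -subr_eq0 -linearB -cycle_evalB.
apply/eqP/rsP/allP => a ars.
by apply/rootP; rewrite hornerD hornerN pq // subrr.
Qed.

(** The choices at different vertices are independent. Uniqueness of the bad cycle at a vertex makes
    them agree up to rotation, and equality of the annihilators makes the roots agree up to
    order. *)
Lemma bad_at_next v C rs : bad_at v = Some (C, rs) ->
  exists C' rs', [/\ bad_at (target (cycle_head C)) = Some (C', rs'),
    cyc_seq C' = rcons (cycle_tail C) (cycle_head C) & rs' =i rs].
Proof.
move=> vC; have [Cb Cv [rsU rsP]] := bad_atS vC.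
have [C1 [C1v C1E]] := cycle_rot C.
have C1b := bad_cycle_rot psiM C1v C1E Cb.
case tC : (bad_at (target (cycle_head C))) => [[C' rs']|]; last first.
  by case: (bad_atN tC C1v).
have [C'b C'v [rsU' rsP']] := bad_atS tC.
have C'E : cyc_seq C' = rcons (cycle_tail C) (cycle_head C).
  by rewrite -C1E; apply: (bad_cycle_uniq psiM C1b); rewrite C1v.
exists C', rs'; split=> // a.
have evalE p : psi (cycle_eval C p) = 0 <-> psi (cycle_eval C' p) = 0.
  exact (bad_cycle_rot_eval psiM p C'v C'E Cb).
have rs_in (r s : seq F) : uniq r -> (forall p : {poly F}, all (root p) r -> all (root p) s) ->
    {subset s <= r}.
  move=> rU rP b bs.
  have := allP (rP (\prod_(c <- r) ('X - c%:P)) _) b bs.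
  by rewrite root_prod_XsubC; apply; rewrite all_root_prod_XsubC.
apply/idP/idP.
  by apply: (rs_in rs rs') => // p /rsP/evalE/rsP'.
by apply: (rs_in rs' rs) => // p /rsP'/evalE/rsP.
Qed.

Lemma bad_at_rot v C rs l1 e l2 : bad_at v = Some (C, rs) ->
  cyc_seq C = l1 ++ e :: l2 ->
  exists C' rs', bad_at (source e) = Some (C', rs') /\ cyc_seq C' = e :: l2 ++ l1.
Proof.
elim: l1 v C rs l2 => [|f l1 IHl] v C rs l2 vC CE.
  have [_ Cv _] := bad_atS vC; exists C, rs; rewrite cats0 CE.
  have <- : cycle_head C = e by case: CE.
  by rewrite -/(cyc_vtx C) Cv.
have [C' [rs' [tC' C'E _]]] := bad_at_next vC.
have [|C2 [rs2 [eC2 C2E]]] := IHl _ _ _ (rcons l2 f) tC'.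
  by rewrite C'E; case: CE => -> ->; rewrite rcons_cat.
by exists C2, rs2; split=> //; rewrite C2E cat_rcons.
Qed.

Lemma live_bad_at v C rs e : bad_at v = Some (C, rs) -> source e = v ->
  live (target e) -> e = cycle_head C.
Proof.
move=> vC ev te; apply: contrapT => eC; apply: te.
have [Cb Cv _] := bad_atS vC; rewrite -stararr psiM.
by rewrite (bad_cycle_exit_head psiM Cb _ eC) ?ev // numul0r.
Qed.

(** If 0 were a root, x times its Lagrange polynomial would vanish at all roots; cancelling x puts
    that polynomial in the kernel, against its value 1 at 0. *)
Lemma bad_at_roots_neq0 v C rs : bad_at v = Some (C, rs) -> 0 \notin rs.
Proof.
move=> vC; have [Cb Cv [rsU rsP]] := bad_atS vC; apply/negP => rs0.
have : psi (cycle_eval C ('X * lagrange rs 0)) = 0.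
  apply/rsP/allP => a ars; rewrite rootM.
  have [->|a0] := eqVneq a 0; first by rewrite /root hornerX eqxx.
  by apply/orP; right; apply/rootP; apply: lagrange_other.
move/(psi_eval_root0 psiM)/rsP/allP/(_ 0 rs0)/rootP/eqP.
by rewrite lagrange_self oner_eq0.
Qed.

Lemma labels_uniq v : uniq (labels v).
Proof.
rewrite /labels; case vC : (bad_at v) => [[C rs]|].
  by have [_ _ []] := bad_atS vC.
by case: (break_at v) => //=; rewrite inE eq_sym oner_eq0.
Qed.

Lemma partL v a : psi (vtx v) ** part v a = part v a.
Proof.
rewrite /part; case vC : (bad_at v) => [[C rs]|].
  by have [_ <- _] := bad_atS vC; rewrite -psiM cycle_eval_vtxl.
case bv : (break_at v) => [l|]; last by rewrite -psiM vtxvtx.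
have [[_ _ lP] _] := break_atS bv.
have sv : psi (vtx v) ** (\sum_(e <- l) psi (arr e ** star e)) =
    \sum_(e <- l) psi (arr e ** star e).
  rewrite numul_sumr [LHS]big_seq [RHS]big_seq; apply: eq_bigr => e /lP[<- _].
  by rewrite -psiM numulA vtxarr.
by rewrite /=; case: ifP; rewrite ?numulBr sv // -psiM vtxvtx.
Qed.

Lemma out_ck2_arr v l e : out_ck2 v l -> (e : {classic arrow G}) \in l ->
  (\sum_(f <- l) psi (arr f ** star f)) ** psi (arr e) = psi (arr e).
Proof.
move=> [lU _ _] el; rewrite (bigD1_seq (e : {classic arrow G})) //= numulDl.
rewrite -psiM -numulA stararr arrvtx numul_suml big1 ?addr0 // => f /eqP fe.
by rewrite -psiM -numulA stararr_neq // numul0r linear0.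
Qed.

Lemma out_ck2_star v l e : out_ck2 v l -> (e : {classic arrow G}) \in l ->
  psi (star e) ** (\sum_(f <- l) psi (arr f ** star f)) = psi (star e).
Proof.
move=> [lU _ _] el; rewrite (bigD1_seq (e : {classic arrow G})) //= numulDr.
rewrite -psiM numulA stararr vtxstar numul_sumr big1 ?addr0 // => f /eqP fe.
by rewrite -psiM numulA stararr_neq ?numul0l ?linear0 // => ef; apply: fe.
Qed.

Lemma out_ck2_idem v l : out_ck2 v l ->
  (\sum_(e <- l) psi (arr e ** star e)) ** (\sum_(e <- l) psi (arr e ** star e)) =
  \sum_(e <- l) psi (arr e ** star e).
Proof.
move=> lP; rewrite {2 3}big_seq numul_sumr; apply: eq_bigr => e el.
by rewrite psiM numulA (out_ck2_arr lP el).
Qed.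

Lemma partR v a : part v a ** psi (vtx v) = part v a.
Proof.
rewrite /part; case vC : (bad_at v) => [[C rs]|].
  by have [_ <- _] := bad_atS vC; rewrite -psiM cycle_eval_vtxr.
case bv : (break_at v) => [l|]; last by rewrite -psiM vtxvtx.
have [[_ _ lP] _] := break_atS bv.
have sv : (\sum_(e <- l) psi (arr e ** star e)) ** psi (vtx v) =
    \sum_(e <- l) psi (arr e ** star e).
  rewrite numul_suml [LHS]big_seq [RHS]big_seq; apply: eq_bigr => e /lP[<- _].
  by rewrite -psiM -numulA starvtx.
by rewrite /=; case: ifP; rewrite ?numulBl sv // -psiM vtxvtx.
Qed.

Lemma partM v a b : a \in labels v -> b \in labels v ->
  part v a ** part v b = if a == b then part v a else 0.
Proof.
rewrite /labels; have := partL v; have := partR v; rewrite /part.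
case vC : (bad_at v) => [[C rs]|].
  have [Cb Cv ann] := bad_atS vC => _ _ ars brs; rewrite -psiM -cycle_evalM.
  case: eqVneq => [->|ab].
    apply: eval_congr ann _ => c crs; rewrite hornerM.
    have [->|cb] := eqVneq c b; first by rewrite lagrange_self mulr1.
    by rewrite lagrange_other // mulr0.
  rewrite -(linear0 psi) -(cycle_eval0 F C); apply: eval_congr ann _ => c crs.
  rewrite hornerM horner0; have [->|ca] := eqVneq c a.
    by rewrite (@lagrange_other _ rs b a) ?mulr0.
  by rewrite lagrange_other // mul0r.
case bv : (break_at v) => [l|]; last first.
  by rewrite !inE => _ _ /eqP -> /eqP ->; rewrite eqxx -psiM vtxvtx.
have [lP _] := break_atS bv; have ss := out_ck2_idem lP.
move=> /= pR pL; have := pL 0; have := pR 0; rewrite eqxx.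
set s := \sum_(e <- l) _ in ss pR pL *; move=> sR sL.
rewrite !inE => /orP[]/eqP-> /orP[]/eqP->; rewrite ?eqxx ?oner_eq0 ?[0 == 1]eq_sym ?oner_eq0 //.
- by rewrite numulBr sR ss subrr.
- by rewrite numulBl sL ss subrr.
- by rewrite numulBr !numulBl sR sL ss subrr subr0 -psiM vtxvtx.
Qed.

Lemma part_sum v : \sum_(a <- labels v) part v a = psi (vtx v).
Proof.
rewrite /labels /part; case vC : (bad_at v) => [[C rs]|].
  have [Cb Cv ann] := bad_atS vC; rewrite -linear_sum.
  have -> : \sum_(a <- rs) cycle_eval C (lagrange rs a) =
      cycle_eval C (\sum_(a <- rs) lagrange rs a) by rewrite linear_sum.
  rewrite -Cv -cycle_eval1; apply: eval_congr ann _ => b brs; rewrite hornerC horner_sum.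
  have [rsU _] : annihilator_roots C rs by have [_ _] := bad_atS vC.
  rewrite (bigD1_seq b) //= lagrange_self big1 ?addr0 // => a ab.
  by rewrite lagrange_other // eq_sym.
case: (break_at v) => [l|]; last by rewrite big_seq1.
by rewrite big_cons big_seq1 eqxx oner_eq0 addrC subrK.
Qed.

Lemma part_neq0 v a : live v -> a \in labels v -> part v a <> 0.
Proof.
rewrite /labels /part; case vC : (bad_at v) => [[C rs]|].
  move=> _ ars; have [_ _ [_ rsP]] := bad_atS vC.
  move=> /rsP/allP/(_ a ars)/rootP/eqP; by rewrite lagrange_self oner_eq0.
case bv : (break_at v) => [l|]; last by move=> lv _.
have [lP sv] := break_atS bv => _; rewrite !inE => /orP[]/eqP->.
  rewrite eqxx => s0; case: lP; case: l s0 {bv sv} => // e l s0 lU _ lP.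
  have [_ te] := (lP e).1 (mem_head _ _); apply: te.
  rewrite -stararr psiM -(@out_ck2_arr v (e :: l) e) ?mem_head //.
  by rewrite s0 numul0l numul0r.
by rewrite oner_eq0 => /eqP; rewrite subr_eq0 eq_sym => /eqP.
Qed.


(* On every bad cycle one arrow is dropped, so that the copies of the cycle in
   the new digraph are finite lines. *)
Definition dropped e := exists C rs, bad_at (source e) = Some (C, rs) /\
  point_of (fun u => List.In u (map (@source G) (cyc_seq C))) = Some (source e).

(* The label of the part of the source through which the arrow e restricted to
   the part a of its target factors. *)
Definition lab e a : F := if bad_at (source e) is Some _ then a else 0.

Lemma lab_in e a : live (target e) -> a \in labels (target e) ->
  lab e a \in labels (source e).
Proof.
move=> te; rewrite /lab {2}/labels; case sC : (bad_at (source e)) => [[C rs]|].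
  have eh := live_bad_at sC erefl te.
  have [C' [rs' [tC _ rs'E]]] := bad_at_next sC.
  by rewrite /labels {1}eh tC rs'E.
by move=> _; case: (break_at _) => [l|]; rewrite mem_head.
Qed.

Lemma part0_arr e : live (target e) -> bad_at (source e) = None ->
  part (source e) 0 ** psi (arr e) = psi (arr e).
Proof.
move=> te sN; rewrite /part sN; case sl : (break_at (source e)) => [l|].
  have [lP _] := break_atS sl; rewrite /= eqxx; apply: (out_ck2_arr (v := source e)) (lP) _.
  by case: lP => _ _ ->.
by rewrite -psiM vtxarr.
Qed.

Lemma part0_star e : live (target e) -> bad_at (source e) = None ->
  psi (star e) ** part (source e) 0 = psi (star e).
Proof.
move=> te sN; rewrite /part sN; case sl : (break_at (source e)) => [l|].
  have [lP _] := break_atS sl; rewrite /= eqxx; apply: (out_ck2_star (v := source e)) (lP) _.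
  by case: lP => _ _ ->.
by rewrite -psiM starvtx.
Qed.

(** The arrow intertwines the cycle with its rotation, and the Lagrange polynomials of the two root
    lists agree at every root. *)
Lemma bad_part_arr e C rs a : live (target e) -> bad_at (source e) = Some (C, rs) ->
  part (source e) a ** psi (arr e) = psi (arr e) ** part (target e) a.
Proof.
move=> te sC; have eh := live_bad_at sC erefl te.
have [C' [rs' [tC C'E rs'E]]] := bad_at_next sC.
rewrite -eh in tC C'E.
have [_ C'v ann] := bad_atS tC; rewrite /part sC tC -!psiM.
have -> : cycle_eval C (lagrange rs a) ** arr e = arr e ** cycle_eval C' (lagrange rs a).
  by rewrite eh; apply: cycle_eval_rot; rewrite -eh.
rewrite !psiM; congr (_ ** _); apply: eval_congr ann _ => b brs.
have [->|ba] := eqVneq b a; first by rewrite !lagrange_self.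
by rewrite !lagrange_other // -rs'E.
Qed.

Lemma bad_ck2 e C rs : live (target e) -> bad_at (source e) = Some (C, rs) ->
  psi (arr e) ** psi (star e) = psi (vtx (source e)).
Proof.
move=> te sC; have [Cb Cv _] := bad_atS sC.
rewrite -psiM {1 2}(live_bad_at sC erefl te) -Cv.
exact: (bad_cycle_head psiM Cb).
Qed.

Lemma bad_part_star e C rs a : live (target e) -> bad_at (source e) = Some (C, rs) ->
  psi (star e) ** part (source e) a = part (target e) a ** psi (star e).
Proof.
move=> te sC; rewrite -(partR (source e)) -(bad_ck2 te sC) !numulA.
rewrite -(numulA _ _ (psi (arr e))) (bad_part_arr _ te sC) (numulA (psi (star e))).
by rewrite -psiM stararr partL.
Qed.

Lemma part_arr e a : live (target e) -> a \in labels (target e) ->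
  part (source e) (lab e a) ** (psi (arr e) ** part (target e) a) =
  psi (arr e) ** part (target e) a.
Proof.
move=> te ta; rewrite /lab; case sC : (bad_at (source e)) => [[C rs]|].
  by rewrite numulA (bad_part_arr _ te sC) -numulA partM // eqxx.
by rewrite numulA part0_arr.
Qed.

Lemma part_star e a : live (target e) -> a \in labels (target e) ->
  part (target e) a ** psi (star e) ** part (source e) (lab e a) =
  part (target e) a ** psi (star e).
Proof.
move=> te ta; rewrite -numulA /lab; case sC : (bad_at (source e)) => [[C rs]|].
  by rewrite (bad_part_star _ te sC) numulA partM // eqxx.
by rewrite part0_star.
Qed.

Lemma labels_neq0 v : live v -> exists a, a \in labels v.
Proof.
move=> lv; case lE : (labels v) => [|a s]; last by exists a; rewrite mem_head.
by case: lv; rewrite -part_sum lE big_nil.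
Qed.

(** On a bad cycle the list has the single entry given by the head, where e e^* = v. Elsewhere the
    parts of each target add up to the target, so the sum is that of e e^* over the live arrows, and
    [break_at] compares it with v. *)
Lemma part_ck2 v i (r : seq ({classic arrow G} * F)) :
  live v -> i \in labels v -> uniq r -> r <> [::] ->
  (forall e a, ((e : {classic arrow G}), a) \in r <->
    [/\ live (target e), a \in labels (target e), ~ dropped e,
        source e = v & lab e a = i]) ->
  \sum_(x <- r) psi (arr x.1) ** part (target x.1) x.2 **
    (part (target x.1) x.2 ** psi (star x.1)) = part v i.
Proof.
move=> lv vi rU r0 rP.
have sqE e a : live (target e) -> a \in labels (target e) ->
    psi (arr e) ** part (target e) a ** (part (target e) a ** psi (star e)) =
    psi (arr e) ** part (target e) a ** psi (star e).
  by move=> te ta; rewrite numulA -(numulA (psi (arr e))) partM // eqxx.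
have -> : \sum_(x <- r) psi (arr x.1) ** part (target x.1) x.2 **
    (part (target x.1) x.2 ** psi (star x.1)) =
    \sum_(x <- r) psi (arr x.1) ** part (target x.1) x.2 ** psi (star x.1).
  by rewrite [LHS]big_seq [RHS]big_seq; apply: eq_bigr => -[e a] /rP[te ta _ _ _]; apply: sqE.
case vC : (bad_at v) => [[C rs]|].
  have rE x : x \in r -> x = ((cycle_head C : {classic arrow G}), i).
    case: x => e a /rP[te ta _ ev]; rewrite /lab ev vC => ai.
    by rewrite ai (live_bad_at vC ev te).
  case: r r0 rU rP rE {sqE} => // x [|y r] _ rU rP rE; last first.
    have xE := rE x (mem_head _ _).
    have yE : y = ((cycle_head C : {classic arrow G}), i).
      by apply: rE; rewrite inE mem_head orbT.
    by move: rU; rewrite xE yE /= mem_head.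
  move: rP; rewrite (rE x (mem_head _ _)) => rP; rewrite big_seq1 /=.
  have [te _ _ ev _] := (rP _ _).1 (mem_head _ _).
  have sC : bad_at (source (cycle_head C)) = Some (C, rs) by rewrite ev.
  by rewrite -(bad_part_arr _ te sC) -numulA (bad_ck2 te sC) partR ev.
have lab0 e a : source e = v -> lab e a = 0 by rewrite /lab => ->; rewrite vC.
have nd e : source e = v -> ~ dropped e.
  by move=> ev [C [rs []]]; rewrite ev vC.
(* The part tagged 1 emits no arrow, so a nonempty [r] excludes it. *)
have i0 : i = 0.
  by case: r r0 rP {rU sqE} => // -[e a] r _ /(_ e a)/proj1/(_ (mem_head _ _))[_ _ _ /lab0 -> ->].
pose l := undup (map fst r).
have lE e : (e : {classic arrow G}) \in l <-> source e = v /\ live (target e).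
  rewrite mem_undup; split=> [/mapP[[f a] /rP[te _ _ ev _] ->]//|[ev te]].
  have [a ta] := labels_neq0 te; apply/mapP; exists ((e : {classic arrow G}), a) => //.
  by apply/rP; split=> //; [apply: nd | rewrite i0 lab0].
have lP : out_ck2 v l.
  split=> //; first exact: undup_uniq.
  case: r r0 @l lE {rU rP sqE} => // x r _ l lE l0.
  have : x.1 \in l by rewrite mem_undup map_f ?mem_head.
  by rewrite l0.
rewrite (big_dep_pairs (l := l) (t := fun e => labels (target (e : arrow G)))
  (fun e a => psi (arr e) ** part (target e) a ** psi (star e))) //; first last.
- move=> e a; apply/idP/andP => [/rP[te ta _ ev _]|[el ta]]; first by split=> //; apply/lE.
  by have [ev te] := (lE _).1 el; apply/rP; split=> //; [apply: nd | rewrite i0 lab0].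
- by move=> e; apply: labels_uniq.
- exact: undup_uniq.
have -> : \sum_(e <- l) \sum_(a <- labels (target (e : arrow G)))
    psi (arr e) ** part (target e) a ** psi (star e) = \sum_(e <- l) psi (arr e ** star e).
  apply: eq_bigr => e _; rewrite -numul_suml -numul_sumr part_sum.
  by rewrite -!psiM arrvtx.
rewrite i0 /part vC; case bv : (break_at v) => [l'|]; last exact: break_atN lP.
rewrite /= eqxx; have [[lU' _ lE'] _] := break_atS bv.
apply: perm_big; apply: uniq_perm => //; first exact: undup_uniq.
by move=> e; apply/idP/idP => [/lE/lE'|/lE'/lE].
Qed.

(** * The new digraph and the relations satisfied by its generators *)

Definition split_vertexP (x : vertex G * F) : bool :=
  `[< live x.1 >] && (x.2 \in labels x.1).

Definition split_arrowP (x : arrow G * F) : bool :=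
  [&& `[< live (target x.1) >], x.2 \in labels (target x.1) & ~~ `[< dropped x.1 >]].

Lemma split_source_subproof (x : {x | split_arrowP x}) :
  split_vertexP (source (sval x).1, lab (sval x).1 (sval x).2).
Proof.
case: x => -[e a] /= /and3P[/asboolP te ta _]; apply/andP; split.
  by apply/asboolP; apply: live_source.
exact: lab_in.
Qed.

Lemma split_target_subproof (x : {x | split_arrowP x}) :
  split_vertexP (target (sval x).1, (sval x).2).
Proof. by case: x => -[e a] /= /and3P[te ta _]; apply/andP. Qed.

Definition split_digraph : digraph := Digraph
  (fun x => exist split_vertexP _ (split_source_subproof x))
  (fun x => exist split_vertexP _ (split_target_subproof x)).

Definition split_gen (g : lpa_gen split_digraph) : A :=
  match g with
  | Vtx x => part (sval x).1 (sval x).2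
  | Arr x => psi (arr (sval x).1) ** part (target (sval x).1) (sval x).2
  | Star x => part (target (sval x).1) (sval x).2 ** psi (star (sval x).1)
  end.

Lemma split_rel t s : lpa_rel t s -> teval split_gen t = teval split_gen s.
Proof.
case=> [v|u v uv|x|x|x|x|x|x y xy|v r r0 rN rP] /=.
- by have /andP[_ vl] := proj2_sig v; rewrite partM // eqxx.
- case: u v uv => [[u a] uP] [[v b] vP] /= uv.
  have /andP[/= /asboolP lu au] := uP; have /andP[/= /asboolP lv bv] := vP.
  case: (pselect (u = v)) => [uv'|nuv].
    rewrite -{v}uv' in vP uv lv bv *; rewrite partM //; case: eqVneq => // ab.
    by case: uv; apply: val_inj; rewrite /= ab.
  by rewrite -partR -[part v b]partL -!numulA (numulA (psi _)) -psiM vtxvtx_neq //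
    linear0 numul0l numul0r.
- by case: x => -[e a] /= /and3P[/asboolP te ta _]; apply: part_arr.
- by case: x => -[e a] /= /and3P[/asboolP te ta _]; rewrite -numulA partM // eqxx.
- by case: x => -[e a] /= /and3P[/asboolP te ta _]; rewrite numulA partM // eqxx.
- by case: x => -[e a] /= /and3P[/asboolP te ta _]; apply: part_star.
- case: x => -[e a] /= /and3P[/asboolP te ta _].
  by rewrite numulA -(numulA (part _ _)) -psiM stararr -numulA partL partM // eqxx.
- case: x y xy => [[e a] eP] [[f b] fP] xy /=.
  have /and3P[/= /asboolP te ta _] := eP; have /and3P[/= /asboolP tf tb _] := fP.
  rewrite numulA -(numulA (part _ _)) -psiM.
  case: (pselect (e = f)) => [ef|nef]; last by rewrite stararr_neq // linear0 numul0r numul0l.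
  rewrite -{f}ef in fP tf tb xy *; rewrite stararr -numulA partL partM //.
  by case: eqVneq => // ab; case: xy; apply: val_inj; rewrite /= ab.
case: v rP => -[v i] vP rP /=; have /andP[/= /asboolP lv iv] := vP.
have -> : teval split_gen (foldr (fun x => TAdd (TMul (TGen (Arr x)) (TGen (Star x)))) TZero r) =
    \sum_(x <- r) psi (arr (sval x).1) ** part (target (sval x).1) (sval x).2 **
      (part (target (sval x).1) (sval x).2 ** psi (star (sval x).1)).
  by elim: (r) => [|x l IHl]; rewrite ?big_nil //= big_cons IHl.
pose r' : seq ({classic arrow G} * F) := map (fun x : arrow split_digraph => sval x) r.
have sum_r' : \sum_(x <- r') psi (arr x.1) ** part (target x.1) x.2 **
    (part (target x.1) x.2 ** psi (star x.1)) = part v i.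
  apply: part_ck2 => //.
  - apply/uniq_NoDup; apply: contrapT => r'N.
    have [s1 [x [s2 [y [s3 [rE xy]]]]]] := not_NoDup_map r'N.
    rewrite rE in rN; rewrite -[_ ++ _]map_id in rN.
    by apply: (NoDup_map_cat_cons rN); apply: val_inj.
  - by rewrite /r'; case: (r) r0.
  move=> e a; split=> [/In_mem/In_map[[[f b] fP] [/= [fe ba] fr]]|[te ta ne ev la]].
    have := (rP _).1 fr => /(congr1 sval)/= [fv lb].
    rewrite -fe -ba; have /and3P[/asboolP tf tb /asboolP nf] := fP.
    by split.
  have eP : split_arrowP (e, a) by apply/and3P; split=> //; apply/asboolP.
  apply/In_mem/In_map; exists (exist split_arrowP (e, a) eP); split=> //.
  by apply/rP/val_inj; rewrite /= ev la.
by rewrite -sum_r' big_map.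
Qed.

Variable Phi : {linear lpa F split_digraph -> A}.
Hypothesis PhiM : {morph Phi : x y / x ** y}.
Hypothesis Phi_gen : forall g, Phi (pres_gen (@lpa_rel F split_digraph) g) = split_gen g.
Implicit Types (x : arrow split_digraph) (V W : vertex split_digraph).
Local Notation ar x := (sval x).1.

Let PhiV V : Phi (vtx V) = part (sval V).1 (sval V).2.
Proof. exact: Phi_gen. Qed.

Let PhiA x : Phi (arr x) = psi (arr (ar x)) ** part (target (ar x)) (sval x).2.
Proof. exact: Phi_gen. Qed.

Let PhiS x : Phi (star x) = part (target (ar x)) (sval x).2 ** psi (star (ar x)).
Proof. exact: Phi_gen. Qed.

Let ar_live x : live (target (ar x)).
Proof. by case: x => x /= /and3P[/asboolP]. Qed.

Let ar_kept x : ~ dropped (ar x).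
Proof. by case: x => x /= /and3P[_ _ /asboolP]. Qed.

Lemma split_walk V p W : walk V p W ->
  walk (sval V).1 (map (fun x => ar x) p) (sval W).1.
Proof. by elim: p V => [|x p IHp] V /= => [->|[<- /IHp]]. Qed.

(** The only live arrow at a vertex of a bad cycle is the next one of that cycle, and there [lab]
    copies the label. *)
Lemma split_walk_bad V p W : walk V p W -> bad_at (sval V).1 <> None ->
  bad_at (sval W).1 <> None /\
  forall x, List.In x p -> (sval (source x)).2 = (sval V).2.
Proof.
elim: p V => [|x p IHp] V /= => [->//|[xV xp] Vb].
have [|Wb labW] := IHp _ xp.
  move: Vb; rewrite -xV /=; case sC : (bad_at _) => [[C rs]|//] _.
  have [C' [rs' [tC _ _]]] := bad_at_next sC.
  by rewrite (live_bad_at sC erefl (@ar_live x)) tC.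
split=> // y [<-|yp]; first by rewrite -xV.
apply: (etrans (labW y yp)); rewrite -xV /= /lab; move: Vb; rewrite -xV /=.
by case: (bad_at _).
Qed.

Lemma split_walk_good V p W x : walk V p W -> bad_at (sval W).1 = None ->
  List.In x p -> bad_at (source (ar x)) = None.
Proof.
elim: p V => [//|y p IHp] V /= [yV yp] WN [<-|xp]; last exact: IHp yp WN xp.
apply: contrapT => yb; have yw : walk (source y) (y :: p) W by [].
by have [] := split_walk_bad yw yb.
Qed.

(** Forgetting labels keeps the vertices distinct because the label is constant along [D]: it is
    copied over a bad cycle and is 0 everywhere else. *)
Lemma split_cycle (D : graph_cycle split_digraph) : exists C,
  cyc_seq C = map (fun x => ar x) (cyc_seq D) /\ cyc_vtx C = (sval (cyc_vtx D)).1.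
Proof.
have Dw := cyc_walk D; have Cw := split_walk Dw.
have [a labD] : exists a, forall x, List.In x (cyc_seq D) -> (sval (source x)).2 = a.
  case DN : (bad_at (sval (cyc_vtx D)).1) => [c|].
    have [|_ labD] := split_walk_bad Dw; first by rewrite DN.
    by exists (sval (cyc_vtx D)).2.
  exists 0 => x xD; rewrite /= /lab.
  by rewrite (split_walk_good Dw DN xD).
have [//||C CE Cv] := cycle_of_walk Cw; last by exists C.
apply: contrapT => CN; rewrite -map_comp in CN.
have [s1 [x [s2 [y [s3 [DE xy]]]]]] := not_NoDup_map CN.
have := cycle_distinct D; rewrite -/(cyc_seq D) DE => /(@NoDup_map_cat_cons _ _ _ s1 x s2 y s3).
apply; apply: val_inj => /=.
have -> : source (ar x) = source (ar y) by [].
have := labD x; have := labD y; rewrite DE /= => -> => [->//|].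
  by apply/List.in_app_iff; right; left.
by apply/List.in_app_iff; right; right; apply/List.in_app_iff; right; left.
Qed.

(* A bad cycle has lost an arrow, so no cycle of the new digraph lies over it. *)
Lemma split_cycle_good (D : graph_cycle split_digraph) :
  bad_at (sval (cyc_vtx D)).1 = None.
Proof.
case DC : (bad_at _) => [[C0 rs]|//].
have [C [CE Cv]] := split_cycle D.
have [C0b C0v _] := bad_atS DC.
have C0E : cyc_seq C0 = map (fun x => ar x) (cyc_seq D).
  have C0C : cyc_vtx C = cyc_vtx C0 by rewrite Cv C0v.
  by rewrite -CE (bad_cycle_uniq psiM C0b C0C).
have [|u uP uC0] :=
  @point_ofP (fun u => List.In u (map (@source G) (cyc_seq C0))).
  by exists (cyc_vtx C0); left.
have [e [eu eC0]] := (In_map _ _ _).1 uC0.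
have [x [xe _]] : exists x, ar x = e /\ List.In x (cyc_seq D).
  by apply/In_map; rewrite -C0E.
have [l1 [l2 C0l]] := List.in_split _ _ eC0.
have [C1 [rs1 [eC1 C1E]]] := bad_at_rot DC C0l.
case: (@ar_kept x); exists C1, rs1; rewrite xe; split=> //.
(* The chosen point depends only on the set of vertices, which rotation preserves. *)
rewrite eu -uP; congr point_of; apply/funext => w; apply/propext.
rewrite C1E C0l !In_map.
have swap f : List.In f (e :: l2 ++ l1) <-> List.In f (l1 ++ e :: l2).
  by rewrite /= !List.in_app_iff /=; tauto.
by split=> -[f [fw /swap]]; exists f.
Qed.

(** [Phi] cuts each arrow down to a part of its target. The next arrow starts in the part labelled
    0, so the cut is invisible except at the end of the path, where [Z] absorbs it. *)
Lemma Phi_walk V p W Z : walk V p W ->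
  (forall x, List.In x p -> bad_at (source (ar x)) = None) ->
  Phi (vtx W) ** Z = Z ->
  Phi (pth F V p) ** Z = psi (pth F (sval V).1 (map (fun x => ar x) p)) ** Z /\
  Phi (vtx V) ** (Phi (pth F V p) ** Z) = Phi (pth F V p) ** Z.
Proof.
elim: p V => [|x p IHp] V /=.
  by move=> <- _ WZ; rewrite !WZ; split=> //; rewrite -[in RHS]WZ numulA PhiV partL -PhiV WZ.
move=> [xV xp] pN WZ.
have [|IH tx] := IHp _ xp _ WZ; first by move=> y yp; apply: pN; right.
rewrite PhiM PhiA -!numulA; rewrite PhiV /= in tx.
rewrite tx IH psiM -numulA; split=> //.
have xN := pN x (or_introl erefl).
by rewrite PhiV -xV /= /lab xN numulA part0_arr.
Qed.

Lemma Phi_injective : injective Phi.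
Proof.
apply: lpa_injective PhiM _ _ => [V|D p p0].
  by rewrite PhiV; case: V => V /= /andP[/asboolP lV aV]; apply: part_neq0.
have [C [CE Cv]] := split_cycle D; have DN := split_cycle_good D.
have Dw := cyc_walk D; have DP x := @split_walk_good _ _ _ x Dw DN.
have lv : live (cyc_vtx C).
  rewrite Cv; case: (cyc_vtx D) => V /= /andP[/asboolP lV _].
  exact: lV.
pose Y := psi (cyc_pth C); have Yv : Y ** psi (vtx (cyc_vtx C)) = Y.
  by rewrite -psiM (pthvtx F (cyc_walk C)).
have vY : Phi (vtx (cyc_vtx D)) ** Y = Y.
  have xN := DP (cycle_head D) (or_introl erefl).
  have eE : source (cycle_head C) = source (ar (cycle_head D)) by case: CE => ->.
  rewrite PhiV /Y /cyc_pth /= psiM numulA; case: CE => -> _.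
  by rewrite /lab xN part0_arr.
have [XY _] := Phi_walk Dw DP vY.
(* A relation in [D] would thus become a relation in the cycle [C] below it, which is not bad. The
   extra factor x comes from [Y], the image of [C]. *)
have evalY : Phi (cycle_eval D p) ** Y = psi (cycle_eval C ('X * p)).
  rewrite cycle_evalM cycle_evalX psiM !cycle_evalE !peval_morph // -/(cyc_pth C).
  apply: peval_intertwine; first by rewrite vY.
  by rewrite XY -CE -Cv.
move=> pE; apply: (bad_atN DN Cv); split=> //; exists ('X * p); last first.
  by rewrite -evalY pE numul0l.
apply/eqP; rewrite mulf_neq0 ?polyX_eq0 //.
by apply: contra_eq_neq p0 => ->; rewrite horner0 eq_sym oner_eq0.
Qed.

(** * Surjectivity of [Phi] *)

Let im (y : A) := exists z, Phi z = y.

Let imM y z : im y -> im z -> im (y ** z).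
Proof. by move=> [y' <-] [z' <-]; exists (y' ** z'). Qed.

Let imD y z : im y -> im z -> im (y + z).
Proof. by move=> [y' <-] [z' <-]; exists (y' + z'); rewrite linearD. Qed.

Let imZ a y : im y -> im (a *: y).
Proof. by move=> [y' <-]; exists (a *: y'); rewrite linearZ. Qed.

Let im0 : im 0. Proof. by exists 0; rewrite linear0. Qed.

Let im_sum (I : eqType) (s : seq I) (E : I -> A) :
  {in s, forall i, im (E i)} -> im (\sum_(i <- s) E i).
Proof.
by move=> sE; rewrite big_seq; apply: (@big_ind _ im _ _ im0 imD).
Qed.

Let im_part v a : live v -> a \in labels v -> im (part v a).
Proof.
move=> lv va; have vP : split_vertexP (v, a) by apply/andP; split=> //; apply/asboolP.
by exists (vtx (exist split_vertexP (v, a) vP : vertex split_digraph)); rewrite PhiV.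
Qed.

Let im_vtx v : im (psi (vtx v)).
Proof.
case: (pselect (live v)) => [lv|/contrapT->]; last exact: im0.
by rewrite -part_sum; apply: im_sum => a; apply: im_part.
Qed.

Let im_kept e : ~ dropped e -> im (psi (arr e)) /\ im (psi (star e)).
Proof.
move=> ne; case: (pselect (live (target e))) => [te|te]; last first.
  by rewrite dead_arr ?dead_star.
have xP a : a \in labels (target e) -> split_arrowP (e, a).
  by move=> ta; apply/and3P; split=> //; apply/asboolP.
rewrite -(arrvtx F e) -(vtxstar F e) !psiM -part_sum numul_sumr numul_suml.
split; apply: im_sum => a /xP eP.
  by exists (arr (exist split_arrowP (e, a) eP : arrow split_digraph)); rewrite PhiA.
by exists (star (exist split_arrowP (e, a) eP : arrow split_digraph)); rewrite PhiS.
Qed.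

Let im_path v p : (forall e, List.In e p -> ~ dropped e) ->
  im (psi (pth F v p)) /\ im (psi (pst F v p)).
Proof.
elim: p v => [|e p IHp] v pk /=; first by split; apply: im_vtx.
have [ep pe] := im_kept (pk e (or_introl erefl)).
have [|pp ps] := IHp (target e); first by move=> f fp; apply: pk; right.
by rewrite !psiM; split; apply: imM.
Qed.

(* The dropped arrow acts on the part a of its target as a times the inverse of
   the rest of the cycle. *)
Let im_dropped e : dropped e -> im (psi (arr e)) /\ im (psi (star e)).
Proof.
move=> [C [rs [sC ptC]]].
case: (pselect (live (target e))) => [te|te]; last by rewrite dead_arr ?dead_star.
have eh := live_bad_at sC erefl te; have [Cb Cv _] := bad_atS sC.
have [C' [rs' [tC C'E _]]] := bad_at_next sC.
rewrite -eh in tC C'E; have [C'b C'v ann] := bad_atS tC.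
pose T := cycle_tail C.
have CE : cyc_seq C = e :: T by rewrite /cyc_seq -eh.
have Tw : walk (target e) T (source e).
  by have := cyc_walk C; rewrite CE Cv => -[].
(* The cycle chosen at [source f] is a rotation of [C], so both choices of a point are the same,
   while the sources on [C] are distinct. *)
have Tk f : List.In f T -> ~ dropped f.
  move=> fT [C1 [rs1 [fC1 ptC1]]].
  have [l1 [l2 TE]] := List.in_split _ _ fT.
  have [C2 [rs2 [fC2 C2E]]] := bad_at_rot (l1 := e :: l1) (l2 := l2) (e := f) sC
    (etrans CE (congr1 (cons e) TE)).
  move: fC2; rewrite fC1 => -[C12 _]; rewrite -{C2}C12 in C2E.
  have ef : source e <> source f.
    apply: (@NoDup_map_cat_cons _ _ (@source G) [::] e l1 f l2).
    by have := cycle_distinct C; rewrite -/(cyc_seq C) CE TE.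
  apply: ef; have [<-] : Some (source f) = Some (source e); last by [].
  rewrite -ptC -ptC1; congr point_of; apply/funext => w; apply/propext.
  rewrite C2E CE TE !In_map.
  have swap g : List.In g (f :: l2 ++ e :: l1) <-> List.In g (e :: l1 ++ f :: l2).
    by rewrite /= !List.in_app_iff /=; tauto.
  by split=> -[g [gw /swap]]; exists g.
have [Tp Ts] := im_path (target e) Tk.
have C'pth : psi (cyc_pth C') = psi (pth F (target e) T) ** psi (arr e).
  rewrite /cyc_pth C'E C'v -cats1 -psiM.
  have ew : walk (source e) [:: e] (target e) by [].
  by rewrite (pth_cat F Tw ew) pth1.
have partE a : a \in rs' -> part (target e) a = psi (cycle_eval C' (lagrange rs' a)).
  by rewrite /part tC.
(* Both sides agree at every root: the Lagrange factor vanishes away from [a]. So the cycle acts on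
   the part of [a] as the scalar [a]. *)
have Xa (q : {poly F}) a : a \in rs' -> (forall b, q.[b] = b * (lagrange rs' a).[b]) ->
    psi (cycle_eval C' q) = a *: part (target e) a.
  move=> ars' qE; rewrite partE // -linearZ /= -cycle_evalZ.
  apply: eval_congr ann _ => b brs'; rewrite qE hornerZ.
  have [->|ba] := eqVneq b a; first by [].
  by rewrite lagrange_other // !mulr0.
have TT : psi (pst F (target e) T) ** psi (pth F (target e) T) = psi (vtx (source e)).
  by rewrite -psiM (pst_pth F Tw).
have lt : labels (target e) = rs' by rewrite /labels tC.
split.
  rewrite -(arrvtx F e) psiM -part_sum numul_sumr; apply: im_sum => a ars.
  have im_a := im_part te ars; rewrite lt in ars.
  suff -> : psi (arr e) ** part (target e) a =
      a *: (psi (pst F (target e) T) ** part (target e) a).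
    by apply/imZ/imM.
  rewrite -numulZr -(Xa ('X * lagrange rs' a)) //; last by move=> b; rewrite hornerM hornerX.
  rewrite cycle_evalM cycle_evalX psiM C'pth -partE // !numulA TT.
  by rewrite -(psiM (vtx _)) vtxarr.
rewrite -(vtxstar F e) psiM -part_sum numul_suml; apply: im_sum => a ars.
have im_a := im_part te ars; rewrite lt in ars.
have a0 : a != 0.
  by apply: contraNneq (bad_at_roots_neq0 tC) => <-.
suff -> : part (target e) a ** psi (star e) =
    a^-1 *: (part (target e) a ** psi (pth F (target e) T)).
  by apply/imZ/imM.
apply: (@scalerI _ _ a a0); rewrite scalerA divff // scale1r -numulZl.
rewrite -(Xa (lagrange rs' a * 'X)) //; last by move=> b; rewrite hornerM hornerX mulrC.
rewrite cycle_evalM cycle_evalX psiM C'pth -partE // -!numulA (bad_ck2 te sC).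
by rewrite -psiM (pthvtx F Tw).
Qed.

Lemma Phi_surjective y : im y.
Proof.
have [x <-] := psi_surj y.
move: x; apply: presented_alg_ind => [[v|e|e]||x z|a x|x z].
- exact: im_vtx.
- by case: (pselect (dropped e)) => [/im_dropped[]|/im_kept[]].
- by case: (pselect (dropped e)) => [/im_dropped[]|/im_kept[]].
- by rewrite linear0; apply: im0.
- by rewrite linearD; apply: imD.
- by rewrite linearZ; apply: imZ.
- by rewrite psiM; apply: imM.
Qed.

End SplitQuotient.

Lemma nualg_isomorphic_sym (F : fieldType) (A B : nuAlgType F) :
  nualg_isomorphic A B -> nualg_isomorphic B A.
Proof.
move=> [f [fM [g fK gK]]].
have g_linear : linear g.
  by move=> a x y; apply: (can_inj fK); rewrite linearP !gK.
pose h : {linear B -> A} := HB.pack g (GRing.isLinear.Build F B A _ g g_linear).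
exists h; split=> [x y|]; last by exists f.
by apply: (can_inj fK); rewrite fM /= !gK.
Qed.

Lemma split_quotient_leavitt (F : fieldType) (G : digraph) (A : nuAlgType F)
    (psi : {linear lpa F G -> A}) :
  {morph psi : x y / x ** y} -> (forall y, exists x, psi x = y) ->
  (forall C, bad_cycle psi C -> exists rs, annihilator_roots psi C rs) ->
  exists M : digraph, nualg_isomorphic A (lpa F M).
Proof.
move=> psiM psi_surj psi_split.
have /choice[bad_at bad_atP] : forall v, exists o : option (graph_cycle G * seq F),
    if o is Some (C, rs)
    then [/\ bad_cycle psi C, cyc_vtx C = v & annihilator_roots psi C rs]
    else forall C, cyc_vtx C = v -> ~ bad_cycle psi C.
  move=> v; case: (pselect (exists2 C, cyc_vtx C = v & bad_cycle psi C)).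
    by move=> [C Cv Cb]; have [rs rsP] := psi_split C Cb; exists (Some (C, rs)).
  by move=> CN; exists None => C Cv Cb; apply: CN; exists C.
have /choice[break_at break_atP] : forall v, exists o : option (seq {classic arrow G}),
    if o is Some l
    then out_ck2 psi v l /\
      \sum_(e <- l) psi (lpa_arr F e ** lpa_star F e) <> psi (lpa_vtx F v)
    else forall l, out_ck2 psi v l ->
      \sum_(e <- l) psi (lpa_arr F e ** lpa_star F e) = psi (lpa_vtx F v).
  move=> v; case: (pselect (exists l, out_ck2 psi v l /\
      \sum_(e <- l) psi (lpa_arr F e ** lpa_star F e) <> psi (lpa_vtx F v))).
    by move=> [l lP]; exists (Some l).
  by move=> lN; exists None => l lP; apply: contrapT => lv; apply: lN; exists l.
have /choice[point_of point_ofP] : forall P : vertex G -> Prop, exists o,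
    (exists v, P v) -> exists2 v, o = Some v & P v.
  move=> P; case: (pselect (exists v, P v)) => [[v Pv]|PN]; last by exists None.
  by exists (Some v) => _; exists v.
have bad_atS v C rs : bad_at v = Some (C, rs) ->
    [/\ bad_cycle psi C, cyc_vtx C = v & annihilator_roots psi C rs].
  by move=> vC; have := bad_atP v; rewrite vC.
have bad_atN v : bad_at v = None -> forall C, cyc_vtx C = v -> ~ bad_cycle psi C.
  by move=> vN; have := bad_atP v; rewrite vN.
have break_atS v l : break_at v = Some l -> out_ck2 psi v l /\
    \sum_(e <- l) psi (lpa_arr F e ** lpa_star F e) <> psi (lpa_vtx F v).
  by move=> vl; have := break_atP v; rewrite vl.
have break_atN v : break_at v = None -> forall l, out_ck2 psi v l ->
    \sum_(e <- l) psi (lpa_arr F e ** lpa_star F e) = psi (lpa_vtx F v).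
  by move=> vN; have := break_atP v; rewrite vN.
have [Phi [PhiM PhiG]] := presented_universal
  (@split_rel F G A psi psiM bad_at bad_atS bad_atN _ break_atS break_atN point_of).
exists (split_digraph psiM bad_atS bad_atN break_at point_of).
apply: nualg_isomorphic_sym; exists Phi; split=> //.
have Phi_inj := Phi_injective break_atS point_ofP PhiM PhiG.
have /choice[g gP] := Phi_surjective psi_surj PhiM PhiG.
by exists g => x //; apply: Phi_inj; rewrite gP.
Qed.

(** A kernel polynomial of least size divides the others by division with remainder. Its constant
    term is nonzero, since otherwise cancelling x would give a smaller one. *)
Lemma bad_cycle_generator (F : fieldType) (G : digraph) (A : nuAlgType F)
    (psi : {linear lpa F G -> A}) C :
  {morph psi : x y / x ** y} -> bad_cycle psi C ->
  exists2 f : {poly F}, f.[0] = 1 & forall p : {poly F}, psi (cycle_eval C p) = 0 <-> f %| p.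
Proof.
move=> psiM [_ [p0 p00 p0E]].
pose P n := `[< exists p : {poly F}, [/\ p <> 0, psi (cycle_eval C p) = 0 & size p = n] >].
have exP : exists n, P n by exists (size p0); apply/asboolP; exists p0.
case: (ex_minnP exP) => n /asboolP[g [g0 gE gn]] n_min.
have g_min p : psi (cycle_eval C p) = 0 -> (size p < size g)%N -> p = 0.
  move=> pE; rewrite gn ltnNge => pn; apply: contrapT => p_neq0.
  by case/negP: pn; apply: n_min; apply/asboolP; exists p.
have gP p : psi (cycle_eval C p) = 0 <-> g %| p.
  split=> [pE|/dvdpP[q ->]]; last by rewrite cycle_evalM psiM gE numul0r.
  apply/eqP; apply: g_min; last by rewrite ltn_modp; apply/eqP.
  have -> : p %% g = p - p %/ g * g by rewrite {2}(divp_eq p g) addrC addKr.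
  by rewrite cycle_evalB linearB cycle_evalM psiM pE gE numul0r subr0.
have g00 : g.[0] != 0.
  apply/eqP => g00; have /factor_theorem[q qE] : root g 0 by apply/rootP.
  rewrite subr0 in qE; have q0 : q = 0; last by apply: g0; rewrite qE q0 mul0r.
  apply: g_min; first by apply: (psi_eval_root0 psiM); rewrite mulrC -qE.
  rewrite qE size_mulX //; apply/eqP => q0; apply: g0; by rewrite qE q0 mul0r.
exists (g.[0]^-1 *: g); first by rewrite hornerZ mulVf.
by move=> p; rewrite gP dvdpZl // invr_neq0.
Qed.

Lemma dlf_leavitt_quotient (F : fieldType) (G : digraph) (J : ideal (lpa F G)) :
  dlf J -> exists M : digraph, nualg_isomorphic (quot J) (lpa F M).
Proof.
move=> Jdlf; apply: (@split_quotient_leavitt F G (quot J) (quot_map J)).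
- exact: quot_mapM.
- by move=> y; exists (repr y); rewrite /= /quot_map reprK.
move=> C Cb; have [f f0 fP] := bad_cycle_generator (@quot_mapM _ _ J) Cb.
have f_neq0 : f <> 0 by move=> fz; move/eqP: f0; rewrite fz horner0 eq_sym oner_eq0.
have [|c [rs [rsU fE]]] := Jdlf C f.
  split=> // [|p]; last by rewrite -fP quot_map_eq0.
  split=> traceE.
    case: Cb => v0 _; apply: v0; apply/quot_map_eq0.
    have : cycle_alg C (lpa_vtx F (cyc_vtx C)) by exists 1; rewrite ?cycle_eval1.
    by rewrite -traceE => -[].
  have : cycle_trace J C (cycle_eval C f).
    by split; [apply/quot_map_eq0/fP | exists f].
  by rewrite traceE => /cycle_eval_eq0.
exists rs; split=> // p; rewrite fP fE all_root_prod_XsubC // dvdpZl //.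
by apply: contra_not_neq f_neq0 => c0; rewrite fE c0 scale0r.
Qed.

Theorem theorem29 (F : fieldType) (G : digraph) (J : ideal (lpa F G)) :
  (exists L : digraph, nualg_isomorphic (quot J) (lpa F L)) <-> dlf J.
Proof.
split=> [[L iso]|]; first exact: leavitt_quotient_dlf iso.
exact: dlf_leavitt_quotient.
Qed.
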